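(* Let $1\le p<2$ and $\sigma_1,\sigma_2\in L_p[0,1]$. If $D(x,\mu)$ is the solution of $$D'(x)+J(x)D(x)=A_\mu D(x),\quad x\in[0,1],\qquad D(0)=I,$$ then $$D(x,\mu)=e^{xA_\mu}+D^{(0)}(x,\mu)+D^{(1)}(x,\mu),$$ where $$D^{(0)}(x,\mu)=\int_0^x e^{(x-2t)A_\mu}J(t)\,dt+\int_0^x e^{(x-2t)A_\mu}N(x,t)\,dt,$$ and for all $\mu\in P_d$ and $x\in[0,1]$ $$\|D^{(1)}(x,\mu)\|_{M(C[0,1])}\le c\,\gamma_2(\mu),$$ where $c=c(d,\sigma_1,\sigma_2)$.
   Context: $J_0=\begin{pmatrix}1&0\\0&-1\end{pmatrix}$, $J(x)=\begin{pmatrix}0&\sigma_1(x)\\ \sigma_2(x)&0\end{pmatrix}$ with $\sigma_j$ complex-valued, $I$ the $2\times2$ identity, $A_\mu=i\mu J_0$, $\mu\in\mathbb{C}$. A solution has absolutely continuous entries on $[0,1]$ and satisfies the equation a.e. $P_d:=\{\mu\in\mathbb{C}:|\mathrm{Im}\,\mu|\le d\}$. For a Banach space $X$, $M(X)$ is the space of $2\times2$ matrices with entries in $X$, normed by the sum of the norms of the entries. For $0\le t\le x\le1$ put $$\tilde\sigma_1(x,t)=\int_0^{x-t}\sigma_1(t+\xi)\sigma_2(\xi)\,d\xi,\qquad \tilde\sigma_2(x,t)=\int_0^{x-t}\sigma_2(t+\xi)\sigma_1(\xi)\,d\xi,$$ $$(T_\sigma f)(x,t)=\int_0^{x-t}\sigma(t+\xi)f(t+\xi,\xi)\,d\xi=\int_t^x\sigma(s)f(s,s-t)\,ds,$$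 $$N(x,t)=\begin{pmatrix}\tilde\sigma_1(x,t)&-(T_{\sigma_1}\tilde\sigma_2)(x,t)\\-(T_{\sigma_2}\tilde\sigma_1)(x,t)&\tilde\sigma_2(x,t)\end{pmatrix}.$$ Let $q$ be given by $1/p+1/q=1$ ($q=\infty$ if $p=1$). Put $\sigma_0=|\sigma_1|+|\sigma_2|$, $a_1=\|\sigma_1\|_{L_1}+\|\sigma_2\|_{L_1}$, $a_2=\|\sigma_1\|_{L_p}+\|\sigma_2\|_{L_p}$ (norms on $[0,1]$), and $$\gamma_0(x,\mu)=\sum_{j=1}^2\Big(\Big|\int_0^x e^{-2i\mu t}\sigma_j(t)dt\Big|+\Big|\int_0^x e^{2i\mu t}\sigma_j(t)dt\Big|\Big),$$ $$\gamma(\mu)=\sum_{j=1}^2\Big(\Big\|\int_0^x e^{-2i\mu t}\sigma_j(t)dt\Big\|_{L_q}+\Big\|\int_0^x e^{2i\mu t}\sigma_j(t)dt\Big\|_{L_q}\Big),$$ where the $L_q$ norms are taken in the variable $x\in[0,1]$, and $$\gamma_1(\mu)=\int_0^1\sigma_0(s)\gamma_0^2(s,\mu)\,ds,\qquad \gamma_2(\mu)=a_2^2\gamma^2(\mu)+a_1\gamma_1(\mu).$$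
   Formalization: The first integral in D^(0) is taken with a minus sign, -∫_0^x e^{(x-2t)A_μ}J(t)dt; with the printed plus sign the bound fails for σ_1=1, σ_2=0, where D^(1) has norm of order 1/|μ| for large real μ while γ_2(μ)=O(1/μ²). *)

(* Defs.v *)
Set Warnings "-notation-overridden,-notation-incompatible-prefix,-ambiguous-paths".
From mathcomp Require Export all_boot all_order all_algebra.
From mathcomp Require Export all_classical all_reals all_analysis.
From mathcomp Require Export complex.
Export Order.TTheory GRing.Theory Num.Theory numFieldNormedType.Exports.

Set Implicit Arguments.
Unset Strict Implicit.
Unset Printing Implicit Defensive.


Local Open Scope classical_set_scope.
Local Open Scope ring_scope.
Local Open Scope complex_scope.

Definition cabs (R : realType) (z : R[i]) : R := ComplexField.Normc.normc z.

Definition cexp (R : realType) (z : R[i]) : R[i] :=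
  (expR (complex.Re z))%:C * (cos (complex.Im z) +i* sin (complex.Im z)).

Definition mexp (K : numFieldType) (A : 'M[K]_2) : 'M[K]_2 :=
  limn (series (fun n => n`!%:R^-1 *: A ^+ n)).

Definition mx2 (K : Type) (a b c d : K) : 'M[K]_2 :=
  \matrix_(j, k) if j == ord0 then (if k == ord0 then a else b)
                 else (if k == ord0 then c else d).

Definition cint (R : realType) (a b : R) (f : R -> R[i]) : R[i] :=
  (\int[lebesgue_measure]_(t in `[a, b]) complex.Re (f t))
  +i* (\int[lebesgue_measure]_(t in `[a, b]) complex.Im (f t)).

Definition mxint (R : realType) (a b : R) (F : R -> 'M[R[i]]_2) : 'M[R[i]]_2 :=
  \matrix_(j, k) cint a b (fun t => F t j k).

Definition Lnorm01 (R : realType) (r : \bar R) (f : R -> R[i]) : \bar R :=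
  Lnorm lebesgue_measure r ((fun x => (cabs (f x))%:E) \_ `[0%R, 1%R]).

Definition in_Lp01 (R : realType) (p : R) (f : R -> R[i]) : Prop :=
  [/\ measurable_fun (`[0%R, 1%R] : set R) (fun x => complex.Re (f x)),
      measurable_fun (`[0%R, 1%R] : set R) (fun x => complex.Im (f x)) &
      (Lnorm01 p%:E f < +oo)%E].

Definition abs_continuous01 (R : realType) (f : R -> R[i]) : Prop :=
  forall e : R, 0 < e -> exists2 r : R, 0 < r &
    forall (n : nat) (u v : 'I_n -> R),
      (forall k, 0 <= u k /\ u k <= v k /\ v k <= 1) ->
      (forall k l, k != l -> v k <= u l \/ v l <= u k) ->
      \sum_k (v k - u k) < r ->
      \sum_k cabs (f (v k) - f (u k)) < e.

Definition is_derive_mx (R : realType) (D : R -> 'M[R[i]]_2) (x : R)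
    (D' : 'M[R[i]]_2) : Prop :=
  forall j k,
    is_derive x 1 (fun t => complex.Re (D t j k)) (complex.Re (D' j k)) /\
    is_derive x 1 (fun t => complex.Im (D t j k)) (complex.Im (D' j k)).

Definition J0 (R : realType) : 'M[R[i]]_2 := mx2 1 0 0 (- 1).

Definition Jmx (R : realType) (s1 s2 : R -> R[i]) (x : R) : 'M[R[i]]_2 :=
  mx2 0 (s1 x) (s2 x) 0.

Definition Amx (R : realType) (mu : R[i]) : 'M[R[i]]_2 := ('i%C * mu) *: J0 R.

Definition is_solution (R : realType) (s1 s2 : R -> R[i]) (mu : R[i])
    (D : R -> 'M[R[i]]_2) : Prop :=
  [/\ forall j k, abs_continuous01 (fun x => D x j k),
      {ae (@lebesgue_measure R), forall x : R, x \in `[0%R, 1%R] ->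
        exists2 D', is_derive_mx D x D' &
                    D' + Jmx s1 s2 x *m D x = Amx mu *m D x} &
      D 0 = 1%:M].

(* sconv s1 s2 and sconv s2 s1 are the two functions \tilde\sigma_j. *)
Definition sconv (R : realType) (f g : R -> R[i]) (x t : R) : R[i] :=
  cint 0 (x - t) (fun xi => f (t + xi) * g xi).

Definition Top (R : realType) (s : R -> R[i]) (f : R -> R -> R[i]) (x t : R) :
    R[i] :=
  cint 0 (x - t) (fun xi => s (t + xi) * f (t + xi) xi).

Definition Nmx (R : realType) (s1 s2 : R -> R[i]) (x t : R) : 'M[R[i]]_2 :=
  mx2 (sconv s1 s2 x t) (- Top s1 (sconv s2 s1) x t)
      (- Top s2 (sconv s1 s2) x t) (sconv s2 s1 x t).

(* The first integral carries a minus sign: since J(t) e^{tA} = e^{-tA} J(t),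
   the first Picard iterate of D' + J D = A D is - \int_0^x e^{(x-2t)A} J(t) dt.
   With a plus sign there, the bound on the remainder would fail already for
   \sigma_1 = 1, \sigma_2 = 0. *)
Definition Dzero (R : realType) (s1 s2 : R -> R[i]) (mu : R[i]) (x : R) :
    'M[R[i]]_2 :=
  - mxint 0 x (fun t => mexp ((x - 2 * t)%:C *: Amx mu) *m Jmx s1 s2 t)
  + mxint 0 x (fun t => mexp ((x - 2 * t)%:C *: Amx mu) *m Nmx s1 s2 x t).

Definition sigma0 (R : realType) (s1 s2 : R -> R[i]) (x : R) : R :=
  cabs (s1 x) + cabs (s2 x).

Definition a1 (R : realType) (s1 s2 : R -> R[i]) : \bar R :=
  (Lnorm01 1 s1 + Lnorm01 1 s2)%E.

Definition a2 (R : realType) (p : R) (s1 s2 : R -> R[i]) : \bar R :=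
  (Lnorm01 p%:E s1 + Lnorm01 p%:E s2)%E.

Definition fourier_minus (R : realType) (s : R -> R[i]) (mu : R[i]) (x : R) :
    R[i] :=
  cint 0 x (fun t => cexp (- (2 * 'i%C * mu * t%:C)) * s t).

Definition fourier_plus (R : realType) (s : R -> R[i]) (mu : R[i]) (x : R) :
    R[i] :=
  cint 0 x (fun t => cexp (2 * 'i%C * mu * t%:C) * s t).

Definition gamma0 (R : realType) (s1 s2 : R -> R[i]) (x : R) (mu : R[i]) : R :=
  (cabs (fourier_minus s1 mu x) + cabs (fourier_plus s1 mu x)) +
  (cabs (fourier_minus s2 mu x) + cabs (fourier_plus s2 mu x)).

Definition gamma (R : realType) (q : \bar R) (s1 s2 : R -> R[i]) (mu : R[i]) :
    \bar R :=
  ((Lnorm01 q (fourier_minus s1 mu) + Lnorm01 q (fourier_plus s1 mu)) +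
   (Lnorm01 q (fourier_minus s2 mu) + Lnorm01 q (fourier_plus s2 mu)))%E.

Definition gamma1 (R : realType) (s1 s2 : R -> R[i]) (mu : R[i]) : \bar R :=
  (\int[lebesgue_measure]_(x in `[0%R, 1%R])
     (sigma0 s1 s2 x * gamma0 s1 s2 x mu ^+ 2)%:E)%E.

Definition gamma2 (R : realType) (p : R) (q : \bar R) (s1 s2 : R -> R[i])
    (mu : R[i]) : \bar R :=
  (a2 p s1 s2 ^+ 2 * gamma q s1 s2 mu ^+ 2 + a1 s1 s2 * gamma1 s1 s2 mu)%E.

Definition in_MC01 (R : realType) (F : R -> 'M[R[i]]_2) : Prop :=
  forall j k,
    {within `[0%R, 1%R], continuous (fun x => complex.Re (F x j k))} /\
    {within `[0%R, 1%R], continuous (fun x => complex.Im (F x j k))}.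

Definition normMC01 (R : realType) (F : R -> 'M[R[i]]_2) : \bar R :=
  (\sum_j \sum_k
     ereal_sup [set (cabs (F x j k))%:E | x in `[0%R, 1%R]])%E.

(* Main.v *)
Require Import Defs.
From mathcomp Require Import measurable_realfun ess_sup_inf ring lra.

(** A column [(y, z)] of the solution becomes, once the free exponentials are factored out
([u = e^{-imx} y], [v = e^{imx} z]), a solution of the Volterra system
  [u = 1 - int_0^x a v],  [v = - int_0^x b u]  (first column, [column_u], [column_v]),
with [a(t) = s1(t) e^{-2imt}] and [b(t) = s2(t) e^{2imt}].  Picard iteration from [(1, 0)]
produces [B = int b], [F = int a B], [G = int b F], and [1 + F], [- B - G] are the
approximations of [u] and [v] that the theorem subtracts.  The errors [r = u - 1 - F] and
[w = v + B + G] satisfy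
  [r = int a G - int a w],  [w = - int b r],
so a Gronwall inequality with an integrable weight ([gronwall_L1]) bounds [|r| + |w|] by a
constant times the supremum of [|int a G|].

The point is that [int a G] is quadratic in [B], although [G] looks linear in it.  Exchanging
the order of integration gives [G = B F - int a B^2] ([iter3E]), whence
[|int a G| <= Q^2 + |a|_1 P] with [Q = int |a| |B|] and [P = int |a| |B|^2]
([le_cint_iter3]).  Since [B] is one of the Fourier integrals that make up [gamma] and
[gamma0], Hoelder's inequality bounds [Q] by a multiple of [a2 * gamma], while [P] is at
most a multiple of [gamma1]; together this is a multiple of [gamma2] ([quadratic_bound],
[gamma2_ge]).

It remains to recognise [B], [F], [G] in [Dzero].  The entries of [N] are convolutions along
the diagonal, and the substitution [s = t + xi], a shear of the triangle of integration,
turns their oscillating integrals into iterated ones ([cint_tensor_shift],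
[cint_triple_shift], [DzeroE]).  For integrable potentials the inner integrals exist only
almost everywhere, which is why this passes through Fubini's theorem on the plane.  The
second column is the first one with [s1] and [s2] exchanged and [m] replaced by [-m].

Two classical facts are established on the way: an absolutely continuous function is the
integral of its almost everywhere derivative ([ac01_ftc]), by a covering argument with
gauges, and the exponential series of a diagonal complex matrix has the expected sum
([mexp_diag]).

The constant is chosen before the exponent [p].  This is possible because it depends on the
potentials through the weight [|s1| + |s2|] only, and [L_p] is contained in [L_1]
([in_Lp01_cintegrable]). *)

Set Implicit Arguments.
Unset Strict Implicit.
Unset Printing Implicit Defensive.

Local Open Scope classical_set_scope.
Local Open Scope ring_scope.
Local Open Scope complex_scope.

Arguments cexp : simpl never.
Arguments cabs : simpl never.

(** * Complex modulus and exponential *)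

Section Modulus.
Variable R : realType.
Implicit Types x y z : R[i].

Lemma ReD x y : complex.Re (x + y) = complex.Re x + complex.Re y.
Proof. by case: x y => [a b] [c d]. Qed.

Lemma ImD x y : complex.Im (x + y) = complex.Im x + complex.Im y.
Proof. by case: x y => [a b] [c d]. Qed.

Lemma ReN x : complex.Re (- x) = - complex.Re x.
Proof. by case: x. Qed.

Lemma ImN x : complex.Im (- x) = - complex.Im x.
Proof. by case: x. Qed.

Lemma ReM x y : complex.Re (x * y) =
  complex.Re x * complex.Re y - complex.Im x * complex.Im y.
Proof. by case: x y => [a b] [c d]. Qed.

Lemma ImM x y : complex.Im (x * y) =
  complex.Re x * complex.Im y + complex.Im x * complex.Re y.
Proof. by case: x y => [a b] [c d]. Qed.

Lemma ReIm_inj x y :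
  complex.Re x = complex.Re y -> complex.Im x = complex.Im y -> x = y.
Proof. by case: x y => [a b] [c d] /= -> ->. Qed.

Lemma cabsM x y : cabs (x * y) = cabs x * cabs y.
Proof. exact: ComplexField.Normc.normcM. Qed.

Lemma cabs_ge0 x : 0 <= cabs x.
Proof. by case: x => a b; exact: sqrtr_ge0. Qed.

Lemma le_cabsD x y : cabs (x + y) <= cabs x + cabs y.
Proof. exact: le_normcD. Qed.

Lemma cabsN x : cabs (- x) = cabs x.
Proof. exact: normcN. Qed.

Lemma le_cabsB x y : cabs (x - y) <= cabs x + cabs y.
Proof. by rewrite -(cabsN y) le_cabsD. Qed.

Lemma cabs0 : cabs (0 : R[i]) = 0.
Proof. exact: ComplexField.Normc.normc0. Qed.

Lemma cabs1 : cabs (1 : R[i]) = 1.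
Proof. exact: ComplexField.Normc.normc1. Qed.

Lemma cabsR (a : R) : cabs a%:C = `|a|.
Proof. by rewrite /cabs /= expr0n /= addr0 sqrtr_sqr. Qed.

Lemma le_Re_cabs x : `|complex.Re x| <= cabs x.
Proof.
by case: x => a b; rewrite /cabs /= -[leLHS]sqrtr_sqr ler_wsqrtr// lerDl sqr_ge0.
Qed.

Lemma le_Im_cabs x : `|complex.Im x| <= cabs x.
Proof.
by case: x => a b; rewrite /cabs /= -[leLHS]sqrtr_sqr ler_wsqrtr// lerDr sqr_ge0.
Qed.

Lemma le_cabs_ReIm x : cabs x <= `|complex.Re x| + `|complex.Im x|.
Proof.
rewrite {1}[x]complexE; apply: (le_trans (le_cabsD _ _)).
by rewrite cabsM !cabsR /cabs /= expr0n expr1n /= add0r sqrtr1 mul1r.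
Qed.

Lemma cabsE x : cabs x =
  Num.sqrt (complex.Re x ^+ 2 + complex.Im x ^+ 2).
Proof. by case: x. Qed.

Lemma cexp0 : cexp 0 = 1 :> R[i].
Proof.
by rewrite /cexp /= expR0 cos0 sin0; apply: ReIm_inj; rewrite /= ?mul1r ?mul0r ?subr0 ?addr0 ?mulr0.
Qed.

Lemma cexpD x y : cexp (x + y) = cexp x * cexp y.
Proof.
apply: ReIm_inj; rewrite /cexp !(ReM, ImM) /= ReD ImD expRD sinD cosD; ring.
Qed.

Lemma cexpN x : cexp (- x) * cexp x = 1.
Proof. by rewrite -cexpD addNr cexp0. Qed.

Lemma cabs_cexp x : cabs (cexp x) = expR (complex.Re x).
Proof.
rewrite /cexp cabsM cabsR ger0_norm ?expR_ge0//.
by rewrite /cabs /= cos2Dsin2 sqrtr1 mulr1.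
Qed.

End Modulus.

(** * Differentiable complex paths *)

Section PathDerivative.
Variable R : realType.

Definition is_cderive (f : R -> R[i]) (x : R) (f' : R[i]) : Prop :=
  is_derive x 1 (fun t => complex.Re (f t)) (complex.Re f') /\
  is_derive x 1 (fun t => complex.Im (f t)) (complex.Im f').

Lemma is_cderive_eq f x (f' g' : R[i]) :
  is_cderive f x f' -> f' = g' -> is_cderive f x g'.
Proof. by move=> ? <-. Qed.

Lemma is_cderive_cst (c : R[i]) x : is_cderive (fun=> c) x 0.
Proof. by split; exact: is_derive_cst. Qed.

Lemma is_cderive_real x : is_cderive (fun t => t%:C) x 1.
Proof. by split => /=; [exact: is_derive_id|exact: is_derive_cst]. Qed.

Lemma is_cderiveD f g x (f' g' : R[i]) :
  is_cderive f x f' -> is_cderive g x g' ->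
  is_cderive (fun t => f t + g t) x (f' + g').
Proof.
move=> [f1 f2] [g1 g2]; rewrite /is_cderive ReD ImD; split.
- rewrite (_ : (fun t => _) = (fun t => complex.Re (f t)) +
    (fun t => complex.Re (g t))); first exact: is_deriveD.
  by apply/funext => t; rewrite ReD.
- rewrite (_ : (fun t => _) = (fun t => complex.Im (f t)) +
    (fun t => complex.Im (g t))); first exact: is_deriveD.
  by apply/funext => t; rewrite ImD.
Qed.

Lemma is_cderiveM f g x (f' g' : R[i]) :
  is_cderive f x f' -> is_cderive g x g' ->
  is_cderive (fun t => f t * g t) x (f' * g x + f x * g').
Proof.
move=> [f1 f2] [g1 g2]; split.
- rewrite (_ : (fun t => _) =
    (fun t => complex.Re (f t)) * (fun t => complex.Re (g t)) -
    (fun t => complex.Im (f t)) * (fun t => complex.Im (g t))); last first.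
    by apply/funext => t; rewrite ReM.
  apply: is_derive_eq (is_deriveB (is_deriveM f1 g1) (is_deriveM f2 g2)) _.
  by rewrite ReD !ReM /GRing.scale /=; ring.
- rewrite (_ : (fun t => _) =
    (fun t => complex.Re (f t)) * (fun t => complex.Im (g t)) +
    (fun t => complex.Im (f t)) * (fun t => complex.Re (g t))); last first.
    by apply/funext => t; rewrite ImM.
  apply: is_derive_eq (is_deriveD (is_deriveM f1 g2) (is_deriveM f2 g1)) _.
  by rewrite ImD !ImM /GRing.scale /=; ring.
Qed.

Lemma is_cderiveZ f x (f' c : R[i]) :
  is_cderive f x f' -> is_cderive (fun t => c * f t) x (c * f').
Proof.
move=> /(is_cderiveM (is_cderive_cst c x)) h.
by apply: is_cderive_eq h _; rewrite mul0r add0r.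
Qed.

Lemma is_cderive_cexp (w : R[i]) x :
  is_cderive (fun t => cexp (w * t%:C)) x (w * cexp (w * x%:C)).
Proof.
set a := complex.Re w; set b := complex.Im w.
have E t : cexp (w * t%:C) = (expR (a * t) * cos (b * t)) +i*
                            (expR (a * t) * sin (b * t)).
  have [e1 e2] : complex.Re (w * t%:C) = a * t /\ complex.Im (w * t%:C) = b * t.
    by rewrite ReM ImM /= -/a -/b mulr0 subr0 mulr0 add0r.
  by apply: ReIm_inj; rewrite /cexp e1 e2 !(ReM, ImM) /=; ring.
have da : is_derive x 1 (fun t => expR (a * t)) (a * expR (a * x)).
  have -> : (fun t => expR (a * t)) = expR \o (a *: id) by [].
  by apply: is_derive_eq; rewrite /GRing.scale /= mulr1 mulrC.
have dc : is_derive x 1 (fun t => cos (b * t)) (- b * sin (b * x)).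
  have -> : (fun t => cos (b * t)) = cos \o (b *: id) by [].
  by apply: is_derive_eq; rewrite /GRing.scale /=; ring.
have ds : is_derive x 1 (fun t => sin (b * t)) (b * cos (b * x)).
  have -> : (fun t => sin (b * t)) = sin \o (b *: id) by [].
  by apply: is_derive_eq; rewrite /GRing.scale /=; ring.
rewrite (funext E) E; split; rewrite !(ReM, ImM) /= -/a -/b.
- rewrite (_ : (fun t => _) = (fun t => expR (a * t)) * (fun t => cos (b * t)))//.
  by apply: is_derive_eq; rewrite /GRing.scale /=; ring.
- rewrite (_ : (fun t => _) = (fun t => expR (a * t)) * (fun t => sin (b * t)))//.
  by apply: is_derive_eq; rewrite /GRing.scale /=; ring.
Qed.

End PathDerivative.

Section MeanValue.
Variable R : realType.

(** The factor [2] comes from treating real and imaginary parts separately, the mean value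
theorem being false for complex paths. *)
Lemma cabs_mean_value (f df : R -> R[i]) (a b M : R) : a <= b ->
  (forall x, x \in `[a, b] -> is_cderive f x (df x)) ->
  (forall x, x \in `[a, b] -> cabs (df x) <= M) ->
  cabs (f b - f a) <= 2 * M * (b - a).
Proof.
move=> ab fdf dfM.
have main (g dg : R -> R) : (forall x, x \in `[a, b] -> is_derive x 1 g (dg x)) ->
    (forall x, x \in `[a, b] -> `|dg x| <= M) -> `|g b - g a| <= M * (b - a).
  move=> gdg dgM.
  have gc : {within `[a, b], continuous g}.
    by apply: derivable_within_continuous => x /gdg gx; exact: ex_derive.
  have gd x : x \in `]a, b[%R -> is_derive x 1 g (dg x).
    by move=> xab; apply: gdg; exact: subset_itv_oo_cc xab.
  have [c cab ->] := @MVT_segment R g dg a b ab gd gc.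
  by rewrite normrM (ger0_norm (_ : 0 <= b - a)) ?subr_ge0// ler_wpM2r ?subr_ge0 ?dgM.
have HRe : `|complex.Re (f b - f a)| <= M * (b - a).
  rewrite ReD ReN; apply: (main (fun t => complex.Re (f t)) (fun x => complex.Re (df x))) => x xab.
    by have [] := fdf _ xab.
  by rewrite (le_trans (le_Re_cabs _)) ?dfM.
have HIm : `|complex.Im (f b - f a)| <= M * (b - a).
  rewrite ImD ImN; apply: (main (fun t => complex.Im (f t)) (fun x => complex.Im (df x))) => x xab.
    by have [] := fdf _ xab.
  by rewrite (le_trans (le_Im_cabs _)) ?dfM.
rewrite (le_trans (le_cabs_ReIm _))//.
by rewrite -mulrA (_ : 2 = 1 + 1)// mulrDl mul1r lerD.
Qed.

End MeanValue.

(** * The exponential series *)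

Section MatrixExponential.
Variable R : realType.
Implicit Types z : R[i].

Lemma normr_cabs (z : R[i]) : `|z| = (cabs z)%:C.
Proof. by rewrite normc_def cabsE. Qed.

(* the structure from which [mexp] takes its topology *)
Let C : numFieldType := R[i].

Definition exp_sum (n : nat) z : R[i] := \sum_(0 <= k < n) k`!%:R^-1 * z ^+ k.

Lemma is_cderive_exp_sum z n x :
  is_cderive (fun t => exp_sum n.+1 (z * t%:C)) x (z * exp_sum n (z * x%:C)).
Proof.
have dX k : is_cderive (fun t => (z * t%:C) ^+ k) x
    (k%:R * z * (z * x%:C) ^+ k.-1).
  elim: k => [|k IH].
    rewrite !mul0r (_ : (fun t => _) = (fun=> 1)); first exact: is_cderive_cst.
    by apply/funext => t; rewrite expr0.
  rewrite (_ : (fun t => _) = (fun t => (z * t%:C) * (z * t%:C) ^+ k)); last first.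
    by apply/funext => t; rewrite exprS.
  have d1 := is_cderiveZ z (is_cderive_real x).
  apply: is_cderive_eq (is_cderiveM d1 IH) _; case: k {IH} => [|k] /=.
    by rewrite !expr0; ring.
  by rewrite !exprS -[in RHS]natr1; ring.
elim: n => [|n IH].
  rewrite /exp_sum big_geq// mulr0 (_ : (fun t => _) = (fun=> 1)).
    exact: is_cderive_cst.
  by apply/funext => t; rewrite big_nat1 expr0 mulr1 invr1.
rewrite (_ : (fun t => _) = (fun t => exp_sum n.+1 (z * t%:C) +
    n.+1`!%:R^-1 * (z * t%:C) ^+ n.+1)); last first.
  by apply/funext => t; rewrite {1}/exp_sum big_nat_recr.
apply: is_cderive_eq (is_cderiveD IH (is_cderiveZ _ (dX _))) _.
rewrite [in RHS]/exp_sum big_nat_recr//= -/(exp_sum n _).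
have n0 : (n.+1%:R != 0 :> R[i]) by rewrite pnatr_eq0.
have nf0 : (n`!%:R != 0 :> R[i]) by rewrite pnatr_eq0 -lt0n fact_gt0.
rewrite factS natrM invfM; field.
by rewrite nf0 addrC natr1 n0.
Qed.

Lemma cabs_natrV k : cabs ((k%:R : R[i])^-1) = k%:R^-1.
Proof.
rewrite [LHS]ComplexField.Normc.normcV; congr (_^-1).
have -> : (k%:R : R[i]) = (k%:R)%:C by rewrite raddfMn.
by rewrite [LHS]cabsR normr_nat.
Qed.

(** Along [t |-> e^{-tz} S(tz)], where [S] is the partial sum of order [n], the derivative
telescopes to [- z e^{-tz} (tz)^n / n!].  The mean value theorem on [[0, 1]] therefore
compares [S(z)] with [e^z], and no series for the sine and cosine is needed. *)
Lemma exp_sum_bound z n :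
  cabs (cexp z - exp_sum n.+1 z) <=
  2 * cabs z * expR (cabs z) ^+ 2 * exp_coeff (cabs z) n.
Proof.
pose h (t : R) := cexp (- z * t%:C) * exp_sum n.+1 (z * t%:C).
pose dh (t : R) :=
  - z * (cexp (- z * t%:C) * (n`!%:R^-1 * (z * t%:C) ^+ n)).
have hdh t : t \in `[0%R, 1%R] -> is_cderive h t (dh t).
  move=> _.
  apply: is_cderive_eq (is_cderiveM (is_cderive_cexp _ _) (is_cderive_exp_sum _ _ _)) _.
  rewrite /exp_sum big_nat_recr//= -/(exp_sum n _) /dh; ring.
have e1 (w : R[i]) : cabs (cexp w) <= expR (cabs w).
  by rewrite cabs_cexp ler_expR (le_trans (ler_norm _))// le_Re_cabs.
have dhM t : t \in `[0%R, 1%R] ->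
    cabs (dh t) <= cabs z * expR (cabs z) * exp_coeff (cabs z) n.
  rewrite in_itv /= => /andP[t0 t1].
  have zt : cabs z * t <= cabs z by rewrite ler_piMr ?cabs_ge0.
  rewrite /dh cabsM cabsN (cabsM (cexp _)) (cabsM _^-1).
  rewrite -[leRHS]mulrA ler_wpM2l ?cabs_ge0// ler_pM ?cabs_ge0//.
  - by rewrite mulr_ge0 ?cabs_ge0.
  - by rewrite (le_trans (e1 _))// ler_expR cabsM cabsN cabsR ger0_norm.
  - rewrite cabs_natrV /exp_coeff mulrC ler_wpM2r ?invr_ge0//.
    have -> : cabs ((z * t%:C) ^+ n) = (cabs z * t) ^+ n.
      elim: n {dh h hdh} => [|n IH]; first by rewrite !expr0 cabs1.
      by rewrite !exprS cabsM IH cabsM cabsR ger0_norm.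
    by rewrite lerXn2r ?nnegrE ?mulr_ge0 ?cabs_ge0.
have := cabs_mean_value ler01 hdh dhM.
rewrite subr0 mulr1.
have -> : h 0 = 1.
  rewrite /h !mulr0 cexp0 mul1r /exp_sum big_nat_recl//= big1_seq ?addr0 ?expr0 ?invr1 ?mulr1//.
  by move=> i _; rewrite expr0n /= mulr0.
have -> : h 1 = cexp (- z) * exp_sum n.+1 z.
  by rewrite /h (_ : 1%:C = 1)// !mulr1.
move=> H.
have -> : cexp z - exp_sum n.+1 z = - (cexp z * (cexp (- z) * exp_sum n.+1 z - 1)).
  have := cexpN z; rewrite mulrC => E.
  by rewrite mulrBr mulrA E mul1r mulr1 opprB.
rewrite cabsN cabsM.
apply: (le_trans (ler_pM (cabs_ge0 _) (cabs_ge0 _) (e1 z) H)).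
by rewrite le_eqVlt; apply/orP; left; apply/eqP; ring.
Qed.

Lemma cvg_exp_sum z :
  (fun n => exp_sum n z : C) @ \oo --> (cexp z : C).
Proof.
apply/cvgrPdist_le => e e0.
have [er eE] : exists r : R, e = r%:C.
  by exists (complex.Re e); rewrite RRe_real// gtr0_real.
have er0 : 0 < er by rewrite -ltcR -eE.
have : (fun n => 2 * cabs z * expR (cabs z) ^+ 2 * exp_coeff (cabs z) n) @ \oo
    --> (0 : R).
  rewrite -[X in _ --> X](mulr0 (2 * cabs z * expR (cabs z) ^+ 2)).
  by apply: cvgM; [exact: cvg_cst|exact: cvg_exp_coeff].
move/cvgrPdist_le => /(_ er er0); move=> [N _ HN]; exists N.+1 => //= n Nn.
case: n Nn => // n Nn.
rewrite normr_cabs eE lecR (le_trans (exp_sum_bound _ _))//.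
by have := HN n Nn; rewrite /= sub0r normrN; exact: le_trans (ler_norm _).
Qed.

(** Neighbourhoods of a matrix are finite products of neighbourhoods of its entries. *)
Lemma cvg_mx2 (K : numFieldType) (F : nat -> 'M[K]_2) (M : 'M[K]_2) :
  (forall i j, (fun n => F n i j) @ \oo --> M i j) -> F @ \oo --> M.
Proof.
move=> FM A [P MP PA].
have : \forall n \near \oo, forall i, forall j, P i j (F n i j).
  by apply: filter_forall => i; apply: filter_forall => j; exact: FM (MP i j).
by apply: filterS => n nP; exact: PA.
Qed.

Lemma ord2P (P : 'I_2 -> Prop) : P ord0 -> P ord_max -> forall i, P i.
Proof.
move=> P0 P1 [[|[|//]] i2]; first by rewrite (_ : Ordinal i2 = ord0)//; exact: val_inj.
by rewrite (_ : Ordinal i2 = ord_max)//; exact: val_inj.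
Qed.

Lemma mx2_00 K (a b c d : K) : mx2 a b c d ord0 ord0 = a.
Proof. by rewrite mxE. Qed.

Lemma mx2_01 K (a b c d : K) : mx2 a b c d ord0 ord_max = b.
Proof. by rewrite mxE. Qed.

Lemma mx2_10 K (a b c d : K) : mx2 a b c d ord_max ord0 = c.
Proof. by rewrite mxE. Qed.

Lemma mx2_11 K (a b c d : K) : mx2 a b c d ord_max ord_max = d.
Proof. by rewrite mxE. Qed.

Definition mx2E := (mx2_00, mx2_01, mx2_10, mx2_11).

Lemma mx2M (K : pzRingType) (a b c d a' b' c' d' : K) :
  mx2 a b c d *m mx2 a' b' c' d' =
  mx2 (a * a' + b * c') (a * b' + b * d') (c * a' + d * c') (c * b' + d * d').
Proof.
have ord1E : lift ord0 ord0 = ord_max :> 'I_2 by exact: val_inj.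
by apply/matrixP; apply: ord2P; apply: ord2P;
  rewrite mx2E mxE big_ord_recl big_ord1 ord1E !mx2E.
Qed.

Lemma mexp_diag (a b : R[i]) : mexp (mx2 a 0 0 b) = mx2 (cexp a) 0 0 (cexp b).
Proof.
have pow k : mx2 a 0 0 b ^+ k = mx2 (a ^+ k) 0 0 (b ^+ k).
  elim: k => [|k IH].
    by rewrite !expr0; apply/matrixP; apply: ord2P; apply: ord2P; rewrite mx2E mxE.
  by rewrite !exprS IH [LHS]mx2M !(mul0r, mulr0, addr0, add0r).
have sumE n i j : series (fun n => n`!%:R^-1 *: mx2 a 0 0 b ^+ n) n i j =
    mx2 (exp_sum n a) 0 0 (exp_sum n b) i j.
  rewrite /series /= summxE.
  have e k : (k`!%:R^-1 *: mx2 a 0 0 b ^+ k) i j =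
      mx2 (k`!%:R^-1 * a ^+ k) 0 0 (k`!%:R^-1 * b ^+ k) i j.
    by rewrite mxE pow; move: i j; apply: ord2P; apply: ord2P; rewrite !mx2E ?mulr0.
  under eq_bigr do rewrite e.
  clear e; move: i j; apply: ord2P; apply: ord2P; rewrite mx2E;
    under eq_bigr do rewrite mx2E; by [|rewrite big1_seq].
apply: cvg_lim => //.
apply: cvg_mx2 => i j.
under eq_fun do rewrite sumE.
move: i j; apply: ord2P; apply: ord2P; rewrite mx2E; under eq_fun do rewrite mx2E.
- exact: cvg_exp_sum.
- exact: cvg_cst.
- exact: cvg_cst.
- exact: cvg_exp_sum.
Qed.

End MatrixExponential.

(** * Absolutely continuous functions *)

Section Gauge.
Variable R : realType.

(** The supremum of the right endpoints that can be reached from [a] is itself reached, by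
the local hypothesis at that point, and the same hypothesis leads beyond it unless it is
[b].  This is Cousin's lemma: the compactness of an interval in the form suited to radii
that depend on the point. *)
Lemma cousin (P : R -> R -> Prop) (a b : R) : a <= b ->
  (forall x, a <= x <= b -> exists2 d, 0 < d & forall u v,
     a <= u -> u <= x -> x <= v -> v <= b -> x - d < u -> v < x + d -> P u v) ->
  (forall u v w, u <= v -> v <= w -> P u v -> P v w -> P u w) ->
  P a b.
Proof.
move=> ab loc add.
pose S := [set x | a <= x <= b /\ P a x].
have Sa : S a.
  split; first by rewrite lexx.
  by have [|d d0 Pd] := loc a; [rewrite lexx|apply: Pd; rewrite ?ltrBlDr ?ltrDl].
have ubS : has_ubound S by exists b => x [/andP[]].
pose c := sup S.
have ac : a <= c by exact: ub_le_sup.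
have cb : c <= b by apply: ge_sup; [exists a|move=> x [/andP[]]].
have [|d d0 Pd] := loc c; first by rewrite ac cb.
have [|x [/andP[ax xb] Pax] cdx] := sup_adherent d0 (E := S); first by split; [exists a|].
have xc : x <= c by apply: ub_le_sup => //; split => //; rewrite ax xb.
pose c' := Num.min b (c + d / 2).
have cc' : c <= c' by rewrite le_min cb lerDl divr_ge0// ltW.
have c'b : c' <= b by rewrite ge_min lexx.
have Pac' : P a c'.
  apply: (add _ x) => //; first exact: le_trans xc cc'.
  apply: Pd => //; rewrite /c' gt_min; apply/orP; right.
  by rewrite ltrD2l ltr_pdivrMr// ltr_pMr// ltr1n.
have [bc|cb'] := leP b (c + d / 2).
  by move: Pac'; rewrite /c' (min_idPl bc).
have : c' <= c by apply: ub_le_sup => //; split => //; rewrite c'b (le_trans ac).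
rewrite /c' (min_idPr (ltW cb')) gerDl leNgt divr_gt0//.
Qed.

(** A vanishing derivative in the form that [cousin] consumes: a radius depending on the
point. *)
Lemma is_derive0_small (H : R -> R) (x e : R) : 0 < e -> is_derive x 1 H 0 ->
  exists2 d, 0 < d & forall y, `|y - x| < d -> `|H y - H x| <= e * `|y - x|.
Proof.
move=> e0 [dH H0].
have : (fun h => h^-1 *: ((H \o shift x) (h *: 1) - H x)) @ 0^' --> 'D_1 H x.
  exact: dH.
rewrite H0; move/cvgrPdist_le => /(_ e e0) [d /= d0 Hd].
exists d => // y yxd; have [->|yx] := eqVneq y x; first by rewrite !subrr normr0 mulr0.
have := Hd (y - x); rewrite /= sub0r normrN subr_eq0 => /(_ yxd yx).
rewrite sub0r normrN /GRing.scale /= mulr1 subrK normrM normfV.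
by rewrite ler_pdivrMl ?normr_gt0 ?subr_eq0// mulrC.
Qed.

End Gauge.

Section AbsolutelyContinuous.
Variable R : realType.
Notation mu := (@lebesgue_measure R).

(** Ordered lists, unlike the families over ['I_n] of [abs_continuous01], are joined by
concatenation when two adjacent intervals are. *)
Definition subdivision01 (L : seq (R * R)) : Prop :=
  all (fun I => [&& 0 <= I.1, I.1 <= I.2 & I.2 <= 1]) L /\
  pairwise (fun I J => I.2 <= J.1) L.

Definition ac01 (f : R -> R) : Prop := forall e, 0 < e ->
  exists2 r, 0 < r & forall L, subdivision01 L ->
  \sum_(I <- L) (I.2 - I.1) < r -> \sum_(I <- L) `|f I.2 - f I.1| < e.

Lemma abs_continuous01_seq (f : R -> R[i]) (e : R) : abs_continuous01 f -> 0 < e ->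
  exists2 r, 0 < r & forall L, subdivision01 L ->
  \sum_(I <- L) (I.2 - I.1) < r -> \sum_(I <- L) cabs (f I.2 - f I.1) < e.
Proof.
move=> acf e0; have [r r0 fr] := acf e e0; exists r => // L [Lin Lord].
have nthP i : (i < size L)%N -> [&& 0 <= (nth (0, 0) L i).1,
    (nth (0, 0) L i).1 <= (nth (0, 0) L i).2 & (nth (0, 0) L i).2 <= 1].
  by move=> iL; exact: (all_nthP (0, 0) Lin).
have sumE (F : R * R -> R) :
    \sum_(I <- L) F I = \sum_(k < size L) F (nth (0, 0) L k).
  by rewrite (big_nth (0, 0)) big_mkord.
rewrite !sumE => Lr.
apply: (fr _ (fun k => (nth (0, 0) L k).1) (fun k => (nth (0, 0) L k).2)) => //.
- by move=> k; have /and3P[] := nthP k (ltn_ord k).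
- move=> k l kl; have /(pairwiseP (0, 0)) H := Lord.
  case: (ltngtP k l) => [kl'|lk'|/val_inj kl']; [left|right|].
  + exact: (H k l (ltn_ord k) (ltn_ord l)).
  + exact: (H l k (ltn_ord l) (ltn_ord k)).
  + by rewrite kl' eqxx in kl.
Qed.

Lemma abs_continuous01_Re (f : R -> R[i]) :
  abs_continuous01 f -> ac01 (fun x => complex.Re (f x)).
Proof.
move=> acf e e0; have [r r0 fr] := abs_continuous01_seq acf e0.
exists r => // L Ls Lr; apply: le_lt_trans (fr L Ls Lr).
by apply: ler_sum => I _; rewrite -ReN -ReD le_Re_cabs.
Qed.

Lemma abs_continuous01_Im (f : R -> R[i]) :
  abs_continuous01 f -> ac01 (fun x => complex.Im (f x)).
Proof.
move=> acf e e0; have [r r0 fr] := abs_continuous01_seq acf e0.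
exists r => // L Ls Lr; apply: le_lt_trans (fr L Ls Lr).
by apply: ler_sum => I _; rewrite -ImN -ImD le_Im_cabs.
Qed.

Lemma ae_open_cover (P : set R) (e : R) : 0 < e -> {ae mu, forall x : R, P x} ->
  exists U, [/\ open U, ~` P `<=` U & (mu U < e%:E)%E].
Proof.
move=> e0 [N [mN N0 PN]].
have [|U [oU NU mU]] := lebesgue_regularity_outer mN _ e0; first by rewrite [X in (X < _)%E]N0.
exists U; split => //; first exact: subset_trans NU.
rewrite (_ : U = N `|` (U `\` N)); last by rewrite setDUK.
have mUo : measurable U by exact: open_measurable.
rewrite measureU//; [|exact: measurableD|by rewrite setDIK].
by rewrite [X in (X + _)%E]N0 add0e.
Qed.

(** Let [G] be the indefinite integral of [g].  By Lebesgue's differentiation theorem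
[f - G] has derivative [0] outside a null set, which is covered by an open set [U] of small
measure.  The statement [P u v] proved by [cousin] says that the increment of [f - G] over
[[u, v]] is at most [e (v - u)], plus the variation of [f] on finitely many disjoint
intervals whose total length is at most the measure of [U] in [[u, v]], plus the integral of
[|g|] over [U] in [[u, v]].  On [[0, b]] the last two terms are small, by the absolute
continuity of [f] and of the integral. *)
Lemma ac01_ftc (f g : R -> R) : ac01 f ->
  mu.-integrable `[0, 1] (EFin \o g) ->
  {ae mu, forall x : R, x \in `[0%R, 1%R] -> is_derive x 1 f (g x)} ->
  forall x, 0 <= x <= 1 -> f x = f 0 + \int[mu]_(t in `[0, x]) g t.
Proof.
move=> acf ig dfg b /andP[b0 b1].
pose g0 := g \_ `[0, 1].
have ig0 : mu.-integrable setT (EFin \o g0).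
  rewrite /g0 -restrict_EFin; apply/integrable_restrict => //.
  by rewrite setTI.
pose G x := \int[mu]_(t in `]-oo, x]) g0 t.
have ig0S A : measurable A -> mu.-integrable A (EFin \o g0).
  by move=> mA; exact: integrableS ig0.
have Gb u v : u <= v -> G v - G u = \int[mu]_(t in `]u, v]) g0 t.
  by move=> uv; rewrite /G Rintegral_itvB//; exact: ig0S.
have dG : {ae mu, forall x : R, derivable G x 1 /\ derive1 G x = g0 x}.
  apply: FTC1Ny => [y|]; first exact: ig0S.
  exact: integrable_locally.
have good : {ae mu, forall x : R, x \in `[0%R, 1%R] -> is_derive x 1 (f - G) 0}.
  have aeF := ae_filter_ringOfSetsType mu.
  move: dfg dG; apply: filterS2 => x dfx [dGx Gx] x01.
  have {}dGx : is_derive x 1 G (g x).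
    apply: DeriveDef => //; rewrite -derive1E Gx /g0 patchE mem_set//.
  have {}dfx := dfx x01.
  by apply: is_derive_eq; rewrite subrr.
have Hb e : 0 < e -> `|(f b - G b) - (f 0 - G 0)| <= e * (b - 0) + e + e.
  move=> e0.
  have [r r0 fr] := acf e e0.
  have [r' [r'0 gr]] := integral_normr_continuous ig0 e0.
  have rr0 : 0 < Num.min r r' by rewrite lt_min r0 r'0.
  have [U [oU NU]] := ae_open_cover rr0 good.
  rewrite EFin_min lt_min => /andP[Ur Ur'].
  have mU : measurable U by exact: open_measurable.
  have mUI : forall u v : R, measurable (U `&` `]u, v]).
    by move=> u v; exact: measurableI.
  pose P u v := exists L : seq (R * R),
    [/\ subdivision01 L, all (fun I => (u <= I.1) && (I.2 <= v)) L,
       ((\sum_(I <- L) (I.2 - I.1))%:E <= mu (U `&` `]u, v]))%E &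
       `|(f v - G v) - (f u - G u)| <= e * (v - u) +
         \sum_(I <- L) `|f I.2 - f I.1| +
         \int[mu]_(t in U `&` `]u, v]) `|g0 t| ].
  suff [L [Ls _ LU Lb]] : P 0 b.
    apply: (le_trans Lb); rewrite lerD//; last first.
      apply/ltW/gr; first exact: mUI.
      by apply: le_lt_trans Ur'; rewrite le_measure ?inE//; exact: mUI.
    rewrite lerD2l ltW// fr// -lte_fin (le_lt_trans LU)// (le_lt_trans _ Ur)//.
    by rewrite le_measure ?inE//; exact: mUI.
  apply: cousin => // [x /andP[x0 xb]|u v w uv vw [L [L1 L2 L3 L4]] [M [M1 M2 M3 M4]]].
    have x01 : x \in `[0%R, 1%R] by rewrite in_itv /= x0 (le_trans xb).
    have [gx|bx] := pselect (is_derive x 1 (f - G) 0).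
      have [d d0 Hd] := is_derive0_small e0 gx.
      (* around a point of differentiability the term [e (v - u)] suffices *)
      exists d => // u v _ ux xv _ xdu vxd; exists [::]; split => //.
        by rewrite big_nil.
      rewrite big_nil addr0.
      have Hv : `|(f v - G v) - (f x - G x)| <= e * (v - x).
        have h : `|v - x| = v - x by rewrite ger0_norm ?subr_ge0.
        by have := Hd v; rewrite h ltrBlDl; exact.
      have Hu : `|(f u - G u) - (f x - G x)| <= e * (x - u).
        have h : `|u - x| = x - u by rewrite distrC ger0_norm ?subr_ge0.
        by have := Hd u; rewrite h ltrBlDr -ltrBlDl; exact.
      rewrite (le_trans (ler_distD (f x - G x) _ _))//.
      rewrite (distrC (f x - G x)) (_ : e * (v - u) = e * (v - x) + e * (x - u)); last by ring.
      rewrite -[leLHS]addr0 lerD//; first exact: lerD.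
      exact: Rintegral_ge0.
    (* an exceptional point has a neighbourhood inside [U]: the interval itself is listed *)
    have Ux : U x by apply: NU => /(_ x01).
    have [d /= d0 dU] : nbhs x U by exact: open_nbhs_nbhs.
    exists d => // u v u0 ux xv vb xdu vxd.
    have UIE : U `&` `]u, v] = (`]u, v]%classic : set R).
      apply/seteqP; split => [y []//|y yuv]; split => //; apply: dU.
      move: yuv; rewrite /= in_itv /= => /andP[uy yv].
      rewrite /ball_ /= ltr_distlC; apply/andP; split.
        exact: lt_trans uy.
      exact: le_lt_trans vxd.
    exists [:: (u, v)]; split => //=.
    - by split => //=; rewrite u0 (le_trans ux)// (le_trans vb).
    - by rewrite !lexx.
    - rewrite big_seq1 UIE lebesgue_measure_itv /= lte_fin.
      have [uv|vu] := ltP u v; first by rewrite -EFinB.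
      by rewrite lee_fin subr_le0.
    - have uv := le_trans ux xv.
      rewrite big_seq1 UIE (_ : _ - _ = (f v - f u) - (G v - G u)); last by ring.
      rewrite (le_trans (ler_normB _ _))// lerD//; last first.
        by rewrite Gb// le_normr_Rintegral//; exact: ig0S.
      by rewrite lerDr mulr_ge0 ?subr_ge0// ltW.
  have UE : U `&` `]u, w] = (U `&` `]u, v]) `|` (U `&` `]v, w]).
    rewrite -setIUr; congr (_ `&` _).
    apply/seteqP; split => y /=; rewrite !in_itv /=.
      by move=> /andP[uy yw]; case: (leP y v) => yv; [left|right]; apply/andP.
    move=> [|] /andP[h1 h2]; first by rewrite h1 (le_trans h2).
    by rewrite (le_lt_trans uv h1).
  have disj : (U `&` `]u, v]) `&` (U `&` `]v, w]) = set0.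
    apply/seteqP; split => // y /= [[_]]; rewrite in_itv /= => /andP[_ yv] [_].
    by rewrite in_itv /= => /andP[vy _]; move: vy; rewrite ltNge yv.
  exists (L ++ M); split.
  - case: L1 M1 => [La Lp] [Ma Mp]; split; first by rewrite all_cat La.
    rewrite pairwise_cat Lp Mp !andbT; apply/allrelP => I J IL JM.
    have /andP[_ Iv] := allP L2 _ IL; have /andP[vJ _] := allP M2 _ JM.
    exact: le_trans Iv vJ.
  - rewrite all_cat; apply/andP; split.
      apply: sub_all L2 => I /andP[-> h] /=; exact: le_trans h vw.
    by apply: sub_all M2 => I /andP[h ->]; rewrite (le_trans uv h).
  - by rewrite big_cat /= EFinD UE measureU//; [exact: leeD|exact: mUI|exact: mUI].
  - rewrite big_cat /= UE Rintegral_setU; last 4 first.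
    + exact: mUI.
    + exact: mUI.
    + rewrite -UE; have := ig0S _ (mUI u w) => /integrable_abse; exact.
    + by apply/disj_setPS; rewrite disj.
    rewrite (_ : _ - _ = ((f w - G w) - (f v - G v)) + ((f v - G v) - (f u - G u))); last by ring.
    rewrite (le_trans (ler_normD _ _))//.
    apply: le_trans (lerD M4 L4) _.
    by rewrite le_eqVlt; apply/orP; left; apply/eqP; ring.
have G0 : G b - G 0 = \int[mu]_(t in `[0, b]) g t.
  rewrite Gb// Rintegral_itv_obnd_cbnd; last exact: ig0S.
  apply: eq_Rintegral => t; rewrite inE /= in_itv /= => /andP[t0 tb].
  by rewrite /g0 patchE mem_set//= in_itv /= t0 (le_trans tb).
apply/eqP; rewrite -subr_eq0 -G0 -normr_le0; apply/ler_addgt0Pl => e e0.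
rewrite addr0 (_ : _ - _ = (f b - G b) - (f 0 - G 0)); last by ring.
have e30 : 0 < e / 3 by rewrite divr_gt0.
apply: (le_trans (Hb _ e30)).
have : e / 3 * (b - 0) <= e / 3 by rewrite subr0 ler_piMr// ltW.
by lra.
Qed.

End AbsolutelyContinuous.

(** * Measurable and integrable complex functions *)

Definition cmeasurable d (T : measurableType d) (R : realType) (D : set T)
    (f : T -> R[i]) : Prop :=
  measurable_fun D (fun x => complex.Re (f x)) /\
  measurable_fun D (fun x => complex.Im (f x)).

Definition cintegrable d (T : measurableType d) (R : realType)
    (mu : {measure set T -> \bar R}) (D : set T) (f : T -> R[i]) : Prop :=
  mu.-integrable D (fun x => (complex.Re (f x))%:E) /\
  mu.-integrable D (fun x => (complex.Im (f x))%:E).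

(** On an interval with Lebesgue measure this is [cint], by conversion. *)
Definition cintegral d (T : measurableType d) (R : realType)
    (mu : {measure set T -> \bar R}) (D : set T) (f : T -> R[i]) : R[i] :=
  (\int[mu]_(x in D) complex.Re (f x)) +i* (\int[mu]_(x in D) complex.Im (f x)).

Section ComplexMeasurable.
Context d (T : measurableType d) (R : realType) (D : set T).
Implicit Types f g : T -> R[i].

Lemma cmeasurable_cst (c : R[i]) : cmeasurable D (fun=> c).
Proof. by split; exact: measurable_cst. Qed.

Lemma cmeasurableM f g : cmeasurable D f -> cmeasurable D g ->
  cmeasurable D (fun x => f x * g x).
Proof.
move=> [f1 f2] [g1 g2]; split.
- under eq_fun do rewrite ReM.
  by apply: measurable_funB; exact: measurable_funM.
- under eq_fun do rewrite ImM.
  by apply: measurable_funD; exact: measurable_funM.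
Qed.

Lemma cmeasurable_cabs f : cmeasurable D f -> measurable_fun D (fun x => cabs (f x)).
Proof.
move=> [f1 f2]; under eq_fun do rewrite cabsE.
apply: measurableT_comp; last by apply: measurable_funD; exact: measurable_funX.
apply: continuous_measurable_fun; exact: sqrt_continuous.
Qed.

End ComplexMeasurable.

Section Compositions.
Context d1 d2 (T1 : measurableType d1) (T2 : measurableType d2) (R : realType).

Lemma cmeasurable_comp (f : T2 -> R[i]) (phi : T1 -> T2) :
  cmeasurable setT f -> measurable_fun setT phi ->
  cmeasurable setT (fun x => f (phi x)).
Proof.
move=> [f1 f2] mphi.
by split; [exact: (measurableT_comp f1 mphi)|exact: (measurableT_comp f2 mphi)].
Qed.

Lemma cmeasurable_if (b : T1 -> bool) (f : T1 -> R[i]) :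
  measurable_fun setT b -> cmeasurable setT f ->
  cmeasurable setT (fun x => if b x then f x else 0).
Proof.
move=> mb [f1 f2]; split.
  rewrite (_ : (fun x => _) = (fun x => if b x then complex.Re (f x) else 0)).
    exact: measurable_fun_ifT.
  by apply/funext => x; case: ifP.
rewrite (_ : (fun x => _) = (fun x => if b x then complex.Im (f x) else 0)).
  exact: measurable_fun_ifT.
by apply/funext => x; case: ifP.
Qed.

End Compositions.

Section ComplexIntegral.
Context d (T : measurableType d) (R : realType) (mu : {measure set T -> \bar R}).
Variables (D : set T) (mD : measurable D).
Implicit Types f g : T -> R[i].

Lemma cintegrable_meas f : cintegrable mu D f -> cmeasurable D f.
Proof. by move=> [/measurable_int /measurable_EFinP ? /measurable_int /measurable_EFinP]. Qed.

Lemma le_cintegrable f (g : T -> R) : cmeasurable D f ->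
  mu.-integrable D (fun x => (g x)%:E) -> (forall x, D x -> cabs (f x) <= g x) ->
  cintegrable mu D f.
Proof.
move=> [f1 f2] ig fg; split; apply: (le_integrable mD) ig.
- exact/measurable_EFinP.
- move=> x Dx /=; rewrite lee_fin (le_trans (le_Re_cabs _))//.
  by rewrite (le_trans (fg x Dx))// ler_norm.
- exact/measurable_EFinP.
- move=> x Dx /=; rewrite lee_fin (le_trans (le_Im_cabs _))//.
  by rewrite (le_trans (fg x Dx))// ler_norm.
Qed.

Lemma cintegrable_cabs f : cintegrable mu D f ->
  mu.-integrable D (fun x => (cabs (f x))%:E).
Proof.
move=> fi; have fm := cintegrable_meas fi; case: fi => f1 f2.
have /(le_integrable mD) : mu.-integrable D
    (fun x => (`|complex.Re (f x)| + `|complex.Im (f x)|)%:E).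
  rewrite (_ : (fun x => _) = (abse \o (fun x => (complex.Re (f x))%:E)) \+
     (abse \o (fun x => (complex.Im (f x))%:E)))//.
  by apply: integrableD => //; exact: integrable_abse.
apply; first exact/measurable_EFinP/cmeasurable_cabs.
move=> x Dx; rewrite lee_fin ger0_norm ?cabs_ge0// ger0_norm ?addr_ge0//.
exact: le_cabs_ReIm.
Qed.

Lemma cintegrable_bounded f g (M : R) : cintegrable mu D f -> cmeasurable D g ->
  (forall x, D x -> cabs (g x) <= M) -> cintegrable mu D (fun x => g x * f x).
Proof.
move=> fi gm gM; have fm := cintegrable_meas fi.
apply: (@le_cintegrable _ (fun x => M * cabs (f x))).
- exact: cmeasurableM.
- rewrite (_ : (fun x => _) = (fun x => M%:E * (cabs (f x))%:E)%E)//.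
  exact/integrableZl/cintegrable_cabs.
- by move=> x Dx; rewrite cabsM ler_wpM2r ?cabs_ge0// gM.
Qed.

Lemma cintegrableZ f (c : R[i]) : cintegrable mu D f -> cintegrable mu D (fun x => c * f x).
Proof.
by move=> fi; apply: (cintegrable_bounded (M := cabs c)) => //; exact: cmeasurable_cst.
Qed.

Lemma cintegrableD f g : cintegrable mu D f -> cintegrable mu D g ->
  cintegrable mu D (fun x => f x + g x).
Proof.
move=> [f1 f2] [g1 g2]; split.
- by under eq_fun do rewrite ReD EFinD; exact: integrableD.
- by under eq_fun do rewrite ImD EFinD; exact: integrableD.
Qed.

Lemma cintegrableN f : cintegrable mu D f -> cintegrable mu D (fun x => - f x).
Proof.
move=> fi; rewrite (_ : (fun x => _) = (fun x => -1 * f x)); first exact: cintegrableZ.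
by apply/funext => x; rewrite mulN1r.
Qed.

Lemma cintegrableB f g : cintegrable mu D f -> cintegrable mu D g ->
  cintegrable mu D (fun x => f x - g x).
Proof. by move=> fi gi; apply: cintegrableD => //; exact: cintegrableN. Qed.

Lemma eq_cintegral f g : (forall x, D x -> f x = g x) ->
  cintegral mu D f = cintegral mu D g.
Proof.
by move=> fg; congr (_ +i* _); apply: eq_Rintegral => x; rewrite inE => /fg ->.
Qed.

Lemma eq_cintegrable f g : (forall x, D x -> f x = g x) ->
  cintegrable mu D f -> cintegrable mu D g.
Proof.
move=> fg [f1 f2]; split.
- by apply: eq_integrable f1 => // x; rewrite inE => /fg ->.
- by apply: eq_integrable f2 => // x; rewrite inE => /fg ->.
Qed.

Lemma cintegral0 : cintegral mu D (fun=> 0) = 0.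
Proof. by apply: ReIm_inj; rewrite /= /Rintegral integral0. Qed.

Lemma cintegralD f g : cintegrable mu D f -> cintegrable mu D g ->
  cintegral mu D (fun x => f x + g x) = cintegral mu D f + cintegral mu D g.
Proof.
move=> [f1 f2] [g1 g2]; apply: ReIm_inj => /=.
- by under eq_Rintegral do rewrite ReD; rewrite RintegralD.
- by under eq_Rintegral do rewrite ImD; rewrite RintegralD.
Qed.

Lemma cintegralZ f (c : R[i]) : cintegrable mu D f ->
  cintegral mu D (fun x => c * f x) = c * cintegral mu D f.
Proof.
move=> [f1 f2]; set a := complex.Re c; set b := complex.Im c.
have iZ (k : R) (h : T -> R) : mu.-integrable D (fun x => (h x)%:E) ->
    mu.-integrable D (EFin \o (fun x => k * h x)).
  by move=> hi; rewrite (_ : _ \o _ = (fun x => k%:E * (h x)%:E)%E)//; exact: integrableZl.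
apply: ReIm_inj; rewrite ?(ReM, ImM) /=.
- under eq_Rintegral do rewrite ReM.
  by rewrite RintegralB//; [rewrite !RintegralZl|exact: iZ|exact: iZ].
- under eq_Rintegral do rewrite ImM.
  by rewrite RintegralD//; [rewrite !RintegralZl|exact: iZ|exact: iZ].
Qed.

Lemma cintegralN f : cintegrable mu D f ->
  cintegral mu D (fun x => - f x) = - cintegral mu D f.
Proof.
move=> fi; rewrite -mulN1r -cintegralZ//.
by apply: eq_cintegral => x _; rewrite mulN1r.
Qed.

Lemma cintegralB f g : cintegrable mu D f -> cintegrable mu D g ->
  cintegral mu D (fun x => f x - g x) = cintegral mu D f - cintegral mu D g.
Proof.
by move=> fi gi; rewrite cintegralD ?cintegralN//; exact: cintegrableN.
Qed.

(** With [z] the integral, [|z|^2] is the real part of [conj z * z], hence the integral of the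
real part of [conj z * f], which is at most [|z| |f|]. *)
Lemma le_cabs_cintegral f : cintegrable mu D f ->
  cabs (cintegral mu D f) <= \int[mu]_(x in D) cabs (f x).
Proof.
move=> fi; set z := cintegral mu D f.
have [->|z0] := eqVneq z 0.
  by rewrite cabs0; apply: Rintegral_ge0 => x _; exact: cabs_ge0.
have cz0 : 0 < cabs z.
  rewrite lt_neqAle cabs_ge0 andbT eq_sym; apply: contra z0 => /eqP.
  by move/ComplexField.Normc.eq0_normc => ->.
have Jz : complex.Re (conjc z * z) = cabs z ^+ 2.
  rewrite cabsE sqr_sqrtr ?addr_ge0 ?sqr_ge0//.
  by case: (z) => a b /=; rewrite mulNr opprK !expr2.
have cJ : cabs (conjc z) = cabs z.
  by case: (z) => a b; rewrite !cabsE /= sqrrN.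
rewrite -(ler_pM2l cz0) -expr2 -Jz -cintegralZ// -RintegralZl//; last exact: cintegrable_cabs.
have [i1 i2] := cintegrableZ (conjc z) fi.
apply: le_Rintegral => //.
  rewrite (_ : _ \o _ = (fun x => (cabs z)%:E * (cabs (f x))%:E)%E)//.
  exact/integrableZl/cintegrable_cabs.
move=> x Dx; rewrite (le_trans (ler_norm _))// (le_trans (le_Re_cabs _))//.
by rewrite cabsM cJ.
Qed.

End ComplexIntegral.

Section IntervalIntegral.
Context (R : realType).
Notation mu := (@lebesgue_measure R).
Implicit Types f g : R -> R[i].

Lemma cintegrable_sub f a b x : cintegrable mu `[a, b] f ->
  x <= b -> cintegrable mu `[a, x] f.
Proof.
move=> [h1 h2] xb; split.
- by apply: integrableS h1 => //; apply: subset_itvl; rewrite bnd_simp.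
- by apply: integrableS h2 => //; apply: subset_itvl; rewrite bnd_simp.
Qed.

Lemma cintZ (c : R[i]) a b f : cintegrable mu `[a, b] f ->
  cint a b (fun t => c * f t) = c * cint a b f.
Proof. exact: cintegralZ. Qed.

Lemma eq_cint a b (f g : R -> R[i]) : (forall t, a <= t <= b -> f t = g t) ->
  cint a b f = cint a b g.
Proof. by move=> fg; apply: eq_cintegral => t /=; rewrite in_itv; exact: fg. Qed.

Lemma ae_eq_cint a b (f g : R -> R[i]) :
  cintegrable mu `[a, b] f -> cmeasurable `[a, b] g ->
  {ae mu, forall t, a <= t <= b -> f t = g t} ->
  cint a b f = cint a b g.
Proof.
move=> [f1 f2] [g1 g2] fg.
have aeF := ae_filter_ringOfSetsType mu.
congr (_ +i* _); congr fine; apply: ae_eq_integral => //.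
- exact: measurable_int f1.
- exact/measurable_EFinP.
- by apply: filterS fg => t fgt; rewrite /= in_itv => /fgt ->.
- exact: measurable_int f2.
- exact/measurable_EFinP.
- by apply: filterS fg => t fgt; rewrite /= in_itv => /fgt ->.
Qed.

Lemma cint_const0 (x : R) : cint 0 x (fun=> 0 : R[i]) = 0.
Proof. exact: cintegral0. Qed.

Lemma cintD a b f g : cintegrable mu `[a, b] f -> cintegrable mu `[a, b] g ->
  cint a b (fun t => f t + g t) = cint a b f + cint a b g.
Proof. exact: cintegralD. Qed.

Lemma cintB a b f g : cintegrable mu `[a, b] f -> cintegrable mu `[a, b] g ->
  cint a b (fun t => f t - g t) = cint a b f - cint a b g.
Proof. exact: cintegralB. Qed.

Lemma cint_split f x y : 0 <= x -> x <= y -> y <= 1 -> cintegrable mu `[0, 1] f ->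
  cint x y f = cint 0 y f - cint 0 x f.
Proof.
move=> x0 xy y1 fi; have [f1 f2] := cintegrable_sub fi y1.
have main (g : R -> R) : mu.-integrable `[0, y] (EFin \o g) ->
    \int[mu]_(t in `[x, y]) g t = \int[mu]_(t in `[0, y]) g t - \int[mu]_(t in `[0, x]) g t.
  move=> ig; rewrite (Rintegral_itvB ig)// Rintegral_itv_obnd_cbnd//.
  by apply: integrableS ig => //; apply: subset_itvr; rewrite bnd_simp.
by apply: ReIm_inj => /=; exact: main.
Qed.

Lemma cintegrable_sub_left f a b x : a <= x -> cintegrable mu `[a, b] f ->
  cintegrable mu `[x, b] f.
Proof.
move=> ax [h1 h2]; split.
- by apply: integrableS h1 => //; apply: subset_itvr; rewrite bnd_simp.
- by apply: integrableS h2 => //; apply: subset_itvr; rewrite bnd_simp.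
Qed.

Lemma le_cabs_cint f x : cintegrable mu `[0, x] f ->
  cabs (cint 0 x f) <= \int[mu]_(t in `[0, x]) cabs (f t).
Proof. exact: le_cabs_cintegral. Qed.

End IntervalIntegral.

(** * Fubini's theorem, translations and shears *)

Lemma le_abse_fine (R : realType) (y : \bar R) : (`|(fine y)%:E| <= `|y|)%E.
Proof. by case: y => [r| |] //=; rewrite normr0 leey. Qed.

Section Fubini.
Context d1 d2 (T1 : measurableType d1) (T2 : measurableType d2) (R : realType).
Variable m1 : {sigma_finite_measure set T1 -> \bar R}.
Variable m2 : {sigma_finite_measure set T2 -> \bar R}.

Section Real.
Variable h : T1 * T2 -> R.
Hypothesis ih : (m1 \x m2)%E.-integrable setT (EFin \o h).

(** The inner integrals are finite almost everywhere only; elsewhere [fine] puts [0], on a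
null set for the outer integral. *)
Lemma ae_fine_fubini1 : ae_eq m1 setT (fun x => (\int[m2]_y h (x, y))%:E)
  (fubini_F m2 (EFin \o h)).
Proof.
have := integrable_ae measurableT (integrable_fubini_F ih).
have aeF := ae_filter_ringOfSetsType m1.
by apply: filterS => x /(_ I) hx _; rewrite /Rintegral fineK.
Qed.

Lemma measurable_fine_fubini1 : measurable_fun setT (fun x => \int[m2]_y h (x, y)).
Proof. by apply: measurableT_comp => //; exact: (measurable_fubini_F ih). Qed.

Lemma integrable_Rfubini1 : m1.-integrable setT (fun x => (\int[m2]_y h (x, y))%:E).
Proof.
apply: le_integrable (integrable_fubini_F ih) => //.
  exact/measurable_EFinP/measurable_fine_fubini1.
by move=> x _; exact: le_abse_fine.
Qed.

Lemma Rintegral_fubini1 : \int[m1]_x (\int[m2]_y h (x, y)) =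
  fine (\int[(m1 \x m2)%E]_z (h z)%:E).
Proof.
rewrite -(integral12_prod_meas1 ih) {1}/Rintegral; congr fine.
apply: ae_eq_integral => //.
- exact/measurable_EFinP/measurable_fine_fubini1.
- exact: (measurable_fubini_F ih).
- exact: ae_fine_fubini1.
Qed.

Lemma ae_fine_fubini2 : ae_eq m2 setT (fun y => (\int[m1]_x h (x, y))%:E)
  (fubini_G m1 (EFin \o h)).
Proof.
have := ae_integrable2 ih.
have aeF := ae_filter_ringOfSetsType m2.
by apply: filterS => x hx _; rewrite /Rintegral fineK//; exact: integrable_fin_num hx.
Qed.

Lemma Rintegral_fubini2 : \int[m2]_y (\int[m1]_x h (x, y)) =
  fine (\int[(m1 \x m2)%E]_z (h z)%:E).
Proof.
rewrite -(integral21_prod_meas1 ih) {1}/Rintegral; congr fine.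
apply: ae_eq_integral => //.
- apply: measurableT_comp => //; apply: measurableT_comp => //.
  exact: (measurable_fubini_G ih).
- exact: (measurable_fubini_G ih).
- exact: ae_fine_fubini2.
Qed.

End Real.

Variable K : T1 * T2 -> R[i].
Hypothesis iK : cintegrable (m1 \x m2)%E setT K.

Lemma cfubini :
  cintegral m1 setT (fun x => cintegral m2 setT (fun y => K (x, y))) =
  cintegral m2 setT (fun y => cintegral m1 setT (fun x => K (x, y))).
Proof.
case: iK => i1 i2; apply: ReIm_inj => /=.
- by rewrite (Rintegral_fubini1 i1) (Rintegral_fubini2 i1).
- by rewrite (Rintegral_fubini1 i2) (Rintegral_fubini2 i2).
Qed.

Lemma ae_cintegrable1 :
  {ae m1, forall x, cintegrable m2 setT (fun y => K (x, y))}.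
Proof.
case: iK => i1 i2; have := ae_integrable1 i1; have := ae_integrable1 i2.
have aeF := ae_filter_ringOfSetsType m1.
by apply: filterS2 => x.
Qed.

Lemma cintegrable_cfubini1 :
  cintegrable m1 setT (fun x => cintegral m2 setT (fun y => K (x, y))).
Proof. by case: iK => i1 i2; split;
  [exact: (integrable_Rfubini1 i1)|exact: (integrable_Rfubini1 i2)]. Qed.

End Fubini.

Section Translation.
Context (R : realType).
Notation mu := (@lebesgue_measure R).
Local Open Scope ereal_scope.

Lemma measurable_translation (c : R) :
  measurable_fun setT ((fun x => x + c)%R : measurableTypeR R -> measurableTypeR R).
Proof. exact: measurable_funD. Qed.

(** The translated measure gives half-open intervals their length, and this determines
Lebesgue measure. *)
Lemma lebesgue_measure_translation (c : R) A : measurable A ->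
  pushforward mu ((fun x => x + c)%R : measurableTypeR R -> measurableTypeR R) A = mu A.
Proof.
move=> mA.
apply/esym/lebesgue_measure_unique => //=; first exact: measurable_translation.
move=> _ _ [[a b]] _ <-; rewrite /pushforward.
rewrite (_ : _ @^-1` _ = `](a - c)%R, (b - c)%R]%classic); last first.
  by apply/seteqP; split => x /=; rewrite !in_itv /= ltrBlDr lerBrDr.
rewrite !lebesgue_measure_itv /= !lte_fin ltrD2r; case: ifP => // _.
by rewrite -!EFinB; congr (_%:E); ring.
Qed.

Lemma ge0_integral_translation (c : R) (f : R -> \bar R) :
  measurable_fun setT f -> (forall x, 0 <= f x) ->
  \int[mu]_x f (x + c)%R = \int[mu]_x f x.
Proof.
move=> mf f0.
have := @ge0_integral_pushforward _ _ _ _ _ _ (measurable_translation c) mu setT f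
  measurableT mf (fun y _ => f0 y).
rewrite preimage_setT => <-.
apply: eq_measure_integral => /=; first exact: measurable_translation.
by move=> _ A mA _; exact: lebesgue_measure_translation.
Qed.

Lemma Rintegral_translation (c : R) (f : R -> R) : measurable_fun setT f ->
  (\int[mu]_x f (x + c) = \int[mu]_x f x)%R.
Proof.
move=> mf; rewrite /Rintegral; congr fine.
have mEf : measurable_fun setT (EFin \o f) by exact/measurable_EFinP.
rewrite [LHS]integralE [RHS]integralE.
congr (_ - _).
- rewrite -(ge0_integral_translation c (measurable_funepos mEf) (funepos_ge0 _)).
  by apply: eq_integral => x _; rewrite !funeposE.
- rewrite -(ge0_integral_translation c (measurable_funeneg mEf) (funeneg_ge0 _)).
  by apply: eq_integral => x _; rewrite !funenegE.
Qed.

End Translation.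

Lemma cintegral_translation (R : realType) (c : R) (f : R -> R[i]) :
  cmeasurable setT f ->
  cintegral (@lebesgue_measure R) setT (fun x => f (x + c)) =
  cintegral (@lebesgue_measure R) setT f.
Proof.
move=> [m1 m2]; congr (_ +i* _).
- exact: (Rintegral_translation c m1).
- exact: (Rintegral_translation c m2).
Qed.

Section Shear.
Context (R : realType).
Notation mu := (@lebesgue_measure R).
Notation mu2 := (@lebesgue_measure R \x @lebesgue_measure R)%E.
Variable K : R * R -> R[i].
Hypothesis iK : cintegrable mu2 setT K.

Let shear (p : R * R) := (p.1 + p.2, p.2).

Lemma measurable_shear : measurable_fun setT shear.
Proof.
by apply: measurable_fun_pair => //; exact: measurable_funD.
Qed.

(** By Tonelli's theorem with the first variable inside, where the shear is a translation. *)
Lemma integrable_shear (h : R * R -> R) : mu2.-integrable setT (EFin \o h) ->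
  mu2.-integrable setT (EFin \o (fun p => h (p.1 + p.2, p.2))).
Proof.
move=> ih; have mh : measurable_fun setT h by move: ih => /measurable_int /measurable_EFinP.
have mhs : measurable_fun setT (h \o shear) by apply: measurableT_comp => //; exact: measurable_shear.
have mEs : measurable_fun setT (EFin \o (h \o shear)) by exact/measurable_EFinP.
apply: (integrable21ltyP mu mu mEs).2.
have mEh : measurable_fun setT (EFin \o h) by exact/measurable_EFinP.
have := (integrable21ltyP mu mu mEh).1 ih; apply: le_lt_trans.
rewrite le_eqVlt; apply/orP; left; apply/eqP; apply: eq_integral => y _ /=.
rewrite -[RHS](ge0_integral_translation y)//.
apply/measurable_EFinP/measurableT_comp => //.
by apply: (measurableT_comp mh); exact: pair2_measurable.
Qed.

Lemma cintegrable_shear : cintegrable mu2 setT (fun p => K (p.1 + p.2, p.2)).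
Proof. by case: iK => i1 i2; split; [exact: (integrable_shear i1)|exact: (integrable_shear i2)]. Qed.

(** With the first variable inside, the shear is a translation at each fixed [xi]; Fubini's
theorem is applied before and after. *)
Lemma cintegral_shear :
  cintegral mu setT (fun t => cintegral mu setT (fun xi => K (t + xi, xi))) =
  cintegral mu setT (fun s => cintegral mu setT (fun xi => K (s, xi))).
Proof.
rewrite (cfubini cintegrable_shear) (cfubini iK).
apply: eq_cintegral => xi _ /=.
apply: (@cintegral_translation _ xi (fun s => K (s, xi))).
have [m1 m2] := cintegrable_meas iK; split.
- by apply: (measurableT_comp m1); exact: pair2_measurable.
- by apply: (measurableT_comp m2); exact: pair2_measurable.
Qed.

End Shear.

(** * Integrals over a triangle *)

Section Triangle.
Context (R : realType).
Notation mu := (@lebesgue_measure R).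
Notation mu2 := (@lebesgue_measure R \x @lebesgue_measure R)%E.
Implicit Types (f g : R -> R[i]) (K : R * R -> R[i]).

Lemma cint_mkcond a b f :
  cint a b f = cintegral mu setT (fun t => if a <= t <= b then f t else 0).
Proof.
have E (h : R -> R) : \int[mu]_(t in `[a, b]) h t =
    \int[mu]_t (if a <= t <= b then h t else 0).
  rewrite Rintegral_mkcond; apply: eq_Rintegral => t _; rewrite patchE.
  by rewrite mem_setE in_itv.
by rewrite /cint !E; congr (_ +i* _); apply: eq_Rintegral => t _; case: ifP.
Qed.

Lemma cintegrable_mkcond a b f : cintegrable mu `[a, b] f <->
  cintegrable mu setT (fun t => if a <= t <= b then f t else 0).
Proof.
have E (h : R -> R) : mu.-integrable `[a, b] (fun t => (h t)%:E) <->
    mu.-integrable setT (fun t => (if a <= t <= b then h t else 0)%:E).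
  rewrite -[X in mu.-integrable X _]setTI integrable_restrict//.
  rewrite (_ : _ \_ _ = (fun t => (if a <= t <= b then h t else 0)%:E))//.
  by apply/funext => t; rewrite patchE mem_setE in_itv; case: ifP.
have ER t : complex.Re (if a <= t <= b then f t else 0) =
    if a <= t <= b then complex.Re (f t) else 0 by case: ifP.
have EI t : complex.Im (if a <= t <= b then f t else 0) =
    if a <= t <= b then complex.Im (f t) else 0 by case: ifP.
rewrite /cintegrable; under [X in _ <-> _.-integrable _ X /\ _]eq_fun do rewrite ER.
under [X in _ <-> _ /\ _.-integrable _ X]eq_fun do rewrite EI.
by rewrite !E.
Qed.

Lemma cintegrable_tensor f g : cintegrable mu setT f -> cintegrable mu setT g ->
  cintegrable mu2 setT (fun p => f p.1 * g p.2).
Proof.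
move=> fi gi.
have mf := cintegrable_meas fi; have mg := cintegrable_meas gi.
have mp : cmeasurable setT (fun p : R * R => f p.1 * g p.2).
  case: mf mg => f1 f2 [g1 g2].
  by apply: cmeasurableM; split; [exact: (measurableT_comp f1)|
    exact: (measurableT_comp f2)|exact: (measurableT_comp g1)|exact: (measurableT_comp g2)].
apply: (@le_cintegrable _ _ R mu2 setT measurableT _ (fun p => cabs (f p.1 * g p.2)) mp) => //.
have mc : measurable_fun setT (fun p : R * R => (cabs (f p.1 * g p.2))%:E).
  exact/measurable_EFinP/cmeasurable_cabs.
apply: (integrable12ltyP mu mu mc).2.
have /integrableP[_ gfin] := cintegrable_cabs measurableT gi.
have /integrableP[_ ffin] := cintegrable_cabs measurableT fi.
have mcg : measurable_fun setT (fun x => (cabs (g x))%:E).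
  exact/measurable_EFinP/cmeasurable_cabs.
have mcf : measurable_fun setT (fun x => (cabs (f x))%:E).
  exact/measurable_EFinP/cmeasurable_cabs.
under eq_integral => x _.
  under eq_integral => y _ do rewrite /= cabsM normrM EFinM (ger0_norm (cabs_ge0 (f x))).
  rewrite ge0_integralZl//; last 2 first.
  - by apply/measurable_EFinP/measurableT_comp => //; exact: cmeasurable_cabs.
  - by rewrite lee_fin cabs_ge0.
  over.
rewrite ge0_integralZr//; last 2 first.
- by move=> t _; rewrite lee_fin cabs_ge0.
- by apply: integral_ge0 => t _; rewrite lee_fin.
rewrite lte_mul_pinfty//.
- by apply: integral_ge0 => t _; rewrite lee_fin cabs_ge0.
- rewrite ge0_fin_numE; last by apply: integral_ge0 => t _; rewrite lee_fin cabs_ge0.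
  apply: le_lt_trans ffin; rewrite le_eqVlt; apply/orP; left; apply/eqP.
  by apply: eq_integral => t _; rewrite gee0_abs// lee_fin cabs_ge0.
Qed.

Definition tri (x : R) (p : R * R) : bool := [&& 0 <= p.2, p.2 <= p.1 & p.1 <= x].

Definition cut (x : R) K (p : R * R) : R[i] := if tri x p then K p else 0.

Lemma measurable_tri x : measurable_fun setT (tri x).
Proof.
by apply: measurable_and; [|apply: measurable_and]; apply: measurable_fun_ler => //.
Qed.

Lemma cintegrable_cut_tensor x f g :
  cintegrable mu `[0, x] f -> cintegrable mu `[0, x] g ->
  cintegrable mu2 setT (cut x (fun p => f p.1 * g p.2)).
Proof.
move=> /cintegrable_mkcond fi /cintegrable_mkcond gi.
have ti := cintegrable_tensor fi gi.
have mi : cmeasurable setT (fun p => if tri x p then 1 else 0 : R[i]).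
  have mt := measurable_tri x.
  split.
    rewrite (_ : (fun p => _) = (fun p => if tri x p then 1 else 0)).
      exact: measurable_fun_ifT.
    by apply/funext => p; case: ifP.
  rewrite (_ : (fun p => _) = cst 0); first exact: measurable_cst.
  by apply/funext => p; case: ifP.
have mi1 p : setT p -> cabs (if tri x p then 1 else 0 : R[i]) <= 1.
  by move=> _; case: ifP => _; rewrite ?cabs1 ?cabs0.
apply: (eq_cintegrable measurableT _ (cintegrable_bounded measurableT ti mi mi1)) => -[s t] _ /=.
rewrite /cut; case: ifP => [|_]; last by rewrite mul0r.
rewrite /tri /= => /and3P[t0 ts sx].
by rewrite mul1r t0 sx (le_trans t0 ts) (le_trans ts sx).
Qed.

Variables (x : R) (K : R * R -> R[i]).
Hypothesis iK : cintegrable mu2 setT (cut x K).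

Let inner_shift t : (fun xi => cut x K (t + xi, xi)) =
  (fun xi => if 0 <= t <= x then if 0 <= xi <= x - t then K (t + xi, xi) else 0 else 0).
Proof.
apply/funext => xi; rewrite /cut /tri /=.
case: (leP 0 xi) => xi0 //=; last by case: ifP.
rewrite lerDr (lerBrDr xi) (addrC xi).
case: (leP 0 t) => t0 //=; case: (leP (t + xi) x) => h //=; last by case: ifP.
by rewrite (le_trans _ h)// lerDl.
Qed.

Let inner_cut s : cintegral mu setT (fun xi => cut x K (s, xi)) =
  if 0 <= s <= x then cint 0 s (fun xi => K (s, xi)) else 0.
Proof.
case: ifP => [/andP[s0 sx]|sx].
  by rewrite cint_mkcond; apply: eq_cintegral => xi _; rewrite /cut /tri /= sx andbT.
rewrite -[RHS](cintegral0 mu setT).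
apply: eq_cintegral => xi _; rewrite /cut /tri /=; case: ifP => // /and3P[h1 h2 h3].
by rewrite (le_trans h1 h2) h3 in sx.
Qed.

(** The shear [(t, xi) |-> (t + xi, xi)] maps the triangle [t, xi >= 0], [t + xi <= x] onto
[tri x]. *)
Lemma triangle_shift :
  cint 0 x (fun t => cint 0 (x - t) (fun xi => K (t + xi, xi))) =
  cint 0 x (fun s => cint 0 s (fun xi => K (s, xi))).
Proof.
rewrite !cint_mkcond.
transitivity (cintegral mu setT (fun t => cintegral mu setT (fun xi => cut x K (t + xi, xi)))).
  apply: eq_cintegral => t _; rewrite inner_shift; case: ifP => // _; first exact: cint_mkcond.
  by rewrite cintegral0.
rewrite (cintegral_shear iK); apply: eq_cintegral => s _.
exact: inner_cut.
Qed.

Lemma triangle_swap :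
  cint 0 x (fun s => cint 0 s (fun xi => K (s, xi))) =
  cint 0 x (fun xi => cint xi x (fun s => K (s, xi))).
Proof.
transitivity (cintegral mu setT (fun s => cintegral mu setT (fun xi => cut x K (s, xi)))).
  by rewrite cint_mkcond; apply: eq_cintegral => s _; rewrite inner_cut.
rewrite (cfubini iK) cint_mkcond; apply: eq_cintegral => xi _.
case: ifP => [/andP[xi0 xix]|xix].
  by rewrite cint_mkcond; apply: eq_cintegral => s _; rewrite /cut /tri /= xi0.
rewrite -[RHS](cintegral0 mu setT); apply: eq_cintegral => s _.
rewrite /cut /tri /=; case: ifP => // /and3P[h1 h2 h3].
by rewrite h1 (le_trans h2 h3) in xix.
Qed.

(** For merely integrable potentials the integrals defining [sconv] and [Top] exist for
almost every [t] only, which still allows factors to be moved into them under an integral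
in [t]. *)
Lemma ae_cintegrable_shift : {ae mu, forall t, 0 <= t <= x ->
  cintegrable mu `[0, x - t] (fun xi => K (t + xi, xi))}.
Proof.
have := ae_cintegrable1 (cintegrable_shear iK).
have aeF := ae_filter_ringOfSetsType mu.
apply: filterS => t /= + tx; rewrite inner_shift tx.
by move/cintegrable_mkcond.
Qed.

Lemma cintegrable_shift :
  cintegrable mu `[0, x] (fun t => cint 0 (x - t) (fun xi => K (t + xi, xi))).
Proof.
apply/cintegrable_mkcond.
apply: (eq_cintegrable measurableT _ (cintegrable_cfubini1 (cintegrable_shear iK))) => t _ /=.
rewrite inner_shift; case: ifP => _; first by rewrite cint_mkcond.
by rewrite cintegral0.
Qed.

End Triangle.

(** * Integrals depending on a parameter *)

Section ParametricIntegral.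
Context d1 d2 (T1 : measurableType d1) (T2 : measurableType d2) (R : realType).
Variable m2 : {sigma_finite_measure set T2 -> \bar R}.

(** No integrability is assumed: the integrals of the positive and of the negative part are
measurable by Tonelli's theorem, and so is [fine] of their difference, including where it
is not finite.  This applies to [sconv], whose integral need not exist at every point. *)
Lemma measurable_Rintegral_param (h : T1 * T2 -> R) : measurable_fun setT h ->
  measurable_fun setT (fun x => \int[m2]_y h (x, y)).
Proof.
move=> mh; apply: measurableT_comp => //.
have mEh : measurable_fun setT (EFin \o h) by exact/measurable_EFinP.
rewrite (_ : (fun x => _) = (fubini_F m2 ((EFin \o h)^\+)%E \- fubini_F m2 ((EFin \o h)^\-)%E)%E).
  apply: emeasurable_funB.
    by apply: measurable_fun_fubini_tonelli_F => //; exact: measurable_funepos.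
  by apply: measurable_fun_fubini_tonelli_F => //; exact: measurable_funeneg.
apply/funext => x; rewrite [LHS]integralE /fubini_F /=; congr (_ - _)%E.
- by apply: eq_integral => y _; rewrite !funeposE.
- by apply: eq_integral => y _; rewrite !funenegE.
Qed.

Lemma cmeasurable_cintegral_param (k : T1 * T2 -> R[i]) : cmeasurable setT k ->
  cmeasurable setT (fun x => cintegral m2 setT (fun y => k (x, y))).
Proof.
move=> [k1 k2]; split; first exact: (measurable_Rintegral_param k1).
exact: (measurable_Rintegral_param k2).
Qed.

(** For a merely measurable [f] one of the integrals of the real and imaginary parts may
diverge, and then count as [0], without the other; bounding them separately costs the
factor [2]. *)
Lemma le_cabs_cintegral_ereal (f : T2 -> R[i]) : cmeasurable setT f ->
  ((cabs (cintegral m2 setT f))%:E <= 2%:E * \int[m2]_y (cabs (f y))%:E)%E.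
Proof.
move=> mf; have mc : measurable_fun setT (fun y => (cabs (f y))%:E).
  exact/measurable_EFinP/cmeasurable_cabs.
case: mf => f1 f2.
have main (g : T2 -> R) : measurable_fun setT g -> (forall y, `|g y| <= cabs (f y)) ->
    (`|\int[m2]_y g y|%:E <= \int[m2]_y (cabs (f y))%:E)%E.
  move=> mg gf; have mEg : measurable_fun setT (EFin \o g) by exact/measurable_EFinP.
  apply: (le_trans (le_abse_fine _)).
  apply: (le_trans (le_abse_integral _ measurableT mEg)).
  apply: ge0_le_integral => //.
  - exact: measurableT_comp mEg.
  - by move=> y _; rewrite lee_fin.
rewrite (_ : 2%:E = 1 + 1)%E// ge0_muleDl// !mul1e.
apply: (@le_trans _ _ (`|\int[m2]_y complex.Re (f y)|%:E + `|\int[m2]_y complex.Im (f y)|%:E)%E).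
  by rewrite -EFinD lee_fin; exact: le_cabs_ReIm.
by apply: leeD; apply: main => // y; [exact: le_Re_cabs|exact: le_Im_cabs].
Qed.

End ParametricIntegral.

(** * Free waves *)

Section Twist.
Context (R : realType).
Notation mu := (@lebesgue_measure R).
Notation mu2 := (@lebesgue_measure R \x @lebesgue_measure R)%E.
Implicit Types (s : R -> R[i]) (m w : R[i]).

(** The function [e^{2imt}]; the diagonal entries of [e^{x A}] are thus [wave (m / 2) x] and
[wave (- (m / 2)) x]. *)
Definition wave m (t : R) : R[i] := cexp (2 * 'i%C * m * t%:C).
Definition twist m s (t : R) : R[i] := wave m t * s t.

Lemma fourier_minusE s m x : fourier_minus s m x = cint 0 x (twist (- m) s).
Proof. by congr cint; apply/funext => t; congr (cexp _ * _); ring. Qed.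

Lemma waveN m t : wave (- m) t * wave m t = 1.
Proof. by rewrite -(cexpN (2 * 'i%C * m * t%:C)); congr (cexp _ * _); ring. Qed.

Lemma waveD m t u : wave m (t + u) = wave m t * wave m u.
Proof. by rewrite -cexpD; congr cexp; rewrite raddfD /=; ring. Qed.

Lemma cabs_wave m t : cabs (wave m t) = expR (- 2 * complex.Im m * t).
Proof.
have two : (2 : R[i]) = (2 : R)%:C by rewrite rmorph_nat.
by rewrite cabs_cexp two; congr expR; rewrite !(ReM, ImM) /=; ring.
Qed.

Lemma le_cabs_wave m (d t : R) : `|complex.Im m| <= d -> 0 <= t <= 1 ->
  cabs (wave m t) <= expR (2 * d).
Proof.
move=> md /andP[t0 t1]; rewrite cabs_wave ler_expR mulNr mulNr -mulrA -mulrN ler_wpM2l//.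
rewrite (le_trans (ler_norm _))// normrN normrM (ger0_norm t0).
by apply: le_trans md; rewrite ler_piMr.
Qed.

Lemma cmeasurable_derivable (f : R -> R[i]) (f' : R -> R[i]) (D : set R) :
  (forall x, is_cderive f x (f' x)) -> cmeasurable D f.
Proof.
move=> df; split; apply: measurable_funTS; apply: continuous_measurable_fun => x.
- by have [[h _] _] := df x; apply: differentiable_continuous; exact/derivable1_diffP.
- by have [_ [h _]] := df x; apply: differentiable_continuous; exact/derivable1_diffP.
Qed.

Lemma cmeasurable_wave m (D : set R) : cmeasurable D (wave m).
Proof.
by apply: (@cmeasurable_derivable _ (fun x => _)) => x; exact: is_cderive_cexp.
Qed.

Lemma cintegrable_wave m s x : x <= 1 -> cintegrable mu `[0, x] s ->
  cintegrable mu `[0, x] (twist m s).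
Proof.
move=> x1 si; apply: (cintegrable_bounded _ si (cmeasurable_wave _ _)) => // t.
rewrite /= in_itv /= => /andP[t0 tx].
by apply: (le_cabs_wave (lexx `|complex.Im m|)); rewrite t0 (le_trans tx).
Qed.

End Twist.

(** * Oscillating integrals of the convolutions *)

Section Iterates.
Context (R : realType).
Notation mu := (@lebesgue_measure R).
Notation mu2 := (@lebesgue_measure R \x @lebesgue_measure R)%E.
Variables (s1 s2 : R -> R[i]) (m : R[i]).
Hypothesis i1 : cintegrable mu `[0, 1] s1.
Hypothesis i2 : cintegrable mu `[0, 1] s2.

Let al := twist (- m) s1.
Let be := twist m s2.

Let ial x : x <= 1 -> cintegrable mu `[0, x] al.
Proof. by move=> x1; apply: cintegrable_wave => //; exact: cintegrable_sub i1 _. Qed.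

Let ibe x : x <= 1 -> cintegrable mu `[0, x] be.
Proof. by move=> x1; apply: cintegrable_wave => //; exact: cintegrable_sub i2 _. Qed.

Let cutted (f : R -> R[i]) t := if 0 <= t <= 1 then f t else 0.

Let sconv_cut p := cut 1 (fun p => sconv s1 s2 p.1 p.2) p.

(** Up to the factor [2] of [le_cabs_cintegral_ereal], this bounds [sconv s1 s2 s xi] by a
function of the shift [xi] alone.  It is integrable, being the inner integral of a sheared
tensor product. *)
Let M (xi : R) : \bar R :=
  \int[mu]_eta (cabs (cutted s1 (xi + eta) * cutted s2 eta))%:E.

Let k (q : (R * R) * R) : R[i] :=
  if tri 1 q.1 && (0 <= q.2 <= q.1.1 - q.1.2)
  then cutted s1 (q.1.2 + q.2) * cutted s2 q.2 else 0.

Let sconv_cutE p : sconv_cut p = cintegral mu setT (fun eta => k (p, eta)).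
Proof.
rewrite /sconv_cut /cut /k /=; case: ifP => [|_]; last by rewrite cintegral0.
rewrite /tri => /and3P[h1 h2 h3]; rewrite /sconv cint_mkcond.
apply: eq_cintegral => eta _; rewrite andTb; case: ifP => // /andP[e0 e1].
have -> : cutted s1 (p.2 + eta) = s1 (p.2 + eta).
  rewrite /cutted ifT//; apply/andP; split; first exact: addr_ge0.
  by apply: le_trans h3; rewrite addrC -lerBrDr.
have -> : cutted s2 eta = s2 eta.
  rewrite /cutted ifT// e0 /=; apply: le_trans e1 _; apply: le_trans h3.
  by rewrite gerBl.
by [].
Qed.

Let icut1 : cintegrable mu setT (cutted s1).
Proof. exact/cintegrable_mkcond. Qed.

Let icut2 : cintegrable mu setT (cutted s2).
Proof. exact/cintegrable_mkcond. Qed.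

Let ishear : cintegrable mu2 setT (fun p => cutted s1 (p.1 + p.2) * cutted s2 p.2).
Proof. exact: (cintegrable_shear (cintegrable_tensor icut1 icut2)). Qed.

Let M_fin : (\int[mu]_xi M xi < +oo)%E.
Proof.
have ic := cintegrable_cabs measurableT ishear.
have mc := measurable_int _ ic.
apply: le_lt_trans ((integrable12ltyP mu mu mc).1 ic).
rewrite le_eqVlt; apply/orP; left; apply/eqP; apply: eq_integral => xi _.
by apply: eq_integral => eta _ /=; rewrite ger0_norm ?cabs_ge0.
Qed.

Let mM : measurable_fun setT M.
Proof.
have ic := cintegrable_cabs measurableT ishear.
apply: (@measurable_fun_fubini_tonelli_F _ _ _ _ R mu
  (fun p : R * R => (cabs (cutted s1 (p.1 + p.2) * cutted s2 p.2))%:E)).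
  exact: measurable_int ic.
by move=> p; rewrite lee_fin cabs_ge0.
Qed.

Let mk : cmeasurable setT k.
Proof.
apply: cmeasurable_if.
  apply: measurable_and; first exact: (measurableT_comp (measurable_tri 1)).
  apply: measurable_and; first exact: measurable_fun_ler.
  apply: measurable_fun_ler => //; apply: measurable_funB => //.
    exact: (measurableT_comp measurable_fst).
  exact: (measurableT_comp measurable_snd).
apply: cmeasurableM; last by apply: (cmeasurable_comp (cintegrable_meas icut2)).
apply: (cmeasurable_comp (cintegrable_meas icut1)).
apply: measurable_funD => //; exact: (measurableT_comp measurable_snd).
Qed.

Let msconv_cut : cmeasurable setT sconv_cut.
Proof.
have := @cmeasurable_cintegral_param _ _ _ _ _ mu k mk.
by rewrite -(funext sconv_cutE).
Qed.

Let sconv_cut_le p : ((cabs (sconv_cut p))%:E <= 2%:E * M p.2)%E.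
Proof.
have mkp : cmeasurable setT (fun eta => k (p, eta)).
  by apply: (cmeasurable_comp mk); exact: pair1_measurable.
have H := @le_cabs_cintegral_ereal _ _ R mu _ mkp.
rewrite -(sconv_cutE p) in H; apply: (le_trans H) => {H}.
apply: lee_wpmul2l => //; apply: ge0_le_integral => //.
- by move=> eta _; rewrite lee_fin cabs_ge0.
- exact/measurable_EFinP/cmeasurable_cabs.
- apply/measurable_EFinP/cmeasurable_cabs/cmeasurableM.
    by apply: (cmeasurable_comp (cintegrable_meas icut1)); exact: measurable_funD.
  exact: cintegrable_meas icut2.
- by move=> eta _; rewrite lee_fin /k; case: ifP => // _; rewrite cabs0 cabs_ge0.
Qed.

(** The integrand is dominated by [|s2 s| * (2 * M xi)], a product of integrable functions of
one variable each. *)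
Let isconv x : x <= 1 ->
  cintegrable mu2 setT (cut x (fun p => s2 p.1 * sconv s1 s2 p.1 p.2)).
Proof.
move=> x1.
pose F (p : R * R) := if tri x p then
  cutted s2 p.1 * sconv_cut p else 0.
have FE p : F p = cut x (fun p => s2 p.1 * sconv s1 s2 p.1 p.2) p.
  rewrite /F /cut; case: ifP => // /and3P[h1 h2 h3].
  have h4 : p.1 <= 1 := le_trans h3 x1.
  have -> : cutted s2 p.1 = s2 p.1 by rewrite /cutted (le_trans h1 h2) h4.
  by rewrite /sconv_cut /cut /tri h1 h2 h4.
have mF : cmeasurable setT F.
  apply: cmeasurable_if; first exact: measurable_tri.
  apply: cmeasurableM => //.
  by apply: (cmeasurable_comp (cintegrable_meas icut2)); exact: measurable_fst.
suff iF : cintegrable mu2 setT F.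
  refine (@eq_cintegrable _ _ R mu2 setT measurableT F _ _ iF) => p _; exact: FE.
apply: (@le_cintegrable _ _ R mu2 setT measurableT _ (fun p => cabs (F p)) mF) => //.
have mcF : measurable_fun setT (fun p => (cabs (F p))%:E).
  exact/measurable_EFinP/cmeasurable_cabs.
apply: (integrable12ltyP mu mu mcF).2.
have mcb : measurable_fun setT (fun x => (cabs (cutted s2 x))%:E).
  by apply/measurable_EFinP/cmeasurable_cabs; exact: cintegrable_meas icut2.
have bfin : (\int[mu]_x (cabs (cutted s2 x))%:E < +oo)%E.
  have /integrableP[_] := cintegrable_cabs measurableT icut2.
  by under eq_integral => t _ do rewrite gee0_abs ?lee_fin ?cabs_ge0//.
have M0 xi : (0 <= M xi)%E.
  by apply: integral_ge0 => eta _; rewrite lee_fin cabs_ge0.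
apply: (@le_lt_trans _ _ (\int[mu]_x ((cabs (cutted s2 x))%:E *
    (2%:E * \int[mu]_xi M xi)))%E).
  apply: ge0_le_integral => //.
  - by move=> t _; apply: integral_ge0.
  - apply: (@measurable_fun_fubini_tonelli_F _ _ _ _ R mu
      (fun p : R * R => `|(cabs (F p))%:E|%E)) => //.
    exact: measurableT_comp mcF.
  - exact: emeasurable_funM.
  move=> t _; rewrite -ge0_integralZl//.
  rewrite -ge0_integralZl//; last 3 first.
  - exact: emeasurable_funM.
  - by move=> xi _; rewrite mule_ge0// lee_fin.
  - by rewrite lee_fin cabs_ge0.
  apply: ge0_le_integral => //.
  - apply/measurable_EFinP/measurableT_comp => //; apply: cmeasurable_cabs.
    by apply: (cmeasurable_comp mF); exact: pair1_measurable.
  - by do 2 apply: emeasurable_funM => //.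
  move=> xi _; rewrite gee0_abs ?lee_fin ?cabs_ge0// /F; case: ifP => [/and3P[/= h1 h2 h3]|_].
    rewrite cabsM EFinM; apply: lee_wpmul2l; first by rewrite lee_fin cabs_ge0.
    exact: sconv_cut_le.
  by rewrite cabs0 mule_ge0// ?lee_fin ?cabs_ge0// mule_ge0// lee_fin.
have MI0 : (0 <= \int[mu]_xi M xi)%E by exact: integral_ge0.
have fb : (2%:E * \int[mu]_xi M xi)%E \is a fin_num.
  by rewrite fin_numM// ge0_fin_numE.
rewrite ge0_integralZr//; last 2 first.
- by move=> t _; rewrite lee_fin cabs_ge0.
- by rewrite mule_ge0// lee_fin.
rewrite lte_mul_pinfty//; last by rewrite ltey_eq fb.
- by apply: integral_ge0 => t _; rewrite lee_fin cabs_ge0.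
- by rewrite ge0_fin_numE//; apply: integral_ge0 => t _; rewrite lee_fin cabs_ge0.
Qed.

Let itriple x : x <= 1 -> cintegrable mu2 setT
  (cut x (fun p => wave m (p.1 - p.2) * (s2 p.1 * sconv s1 s2 p.1 p.2))).
Proof.
move=> x1; have iK := isconv x1.
pose W (p : R * R) := if tri x p then wave m (p.1 - p.2) else 0.
have mW : cmeasurable setT W.
  apply: cmeasurable_if; first exact: measurable_tri.
  by apply: (cmeasurable_comp (cmeasurable_wave _ _)); exact: measurable_funB.
have W1 p : setT p -> cabs (W p) <= expR (2 * `|complex.Im m|).
  rewrite /W; case: ifP => [/and3P[h1 h2 h3] _|_ _]; last by rewrite cabs0 expR_ge0.
  apply: le_cabs_wave => //; rewrite subr_ge0 h2 (le_trans _ (le_trans h3 x1))//.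
  by rewrite gerBl.
refine (@eq_cintegrable _ _ R mu2 setT measurableT _ _ _
  (cintegrable_bounded measurableT iK mW W1)) => p _ /=.
by rewrite /W /cut; case: ifP => // _; rewrite mul0r.
Qed.

(** As [wave (- m) t = wave (- m) (t + xi) * wave m xi], the oscillating factor can be
distributed over the two potentials before the substitution [s = t + xi]. *)
Lemma cint_tensor_shift x : x <= 1 ->
  cintegrable mu `[0, x] (fun t => wave (- m) t * sconv s1 s2 x t) /\
  cint 0 x (fun t => wave (- m) t * sconv s1 s2 x t) =
  cint 0 x (fun s => al s * cint 0 s be).
Proof.
move=> x1.
have i0 := cintegrable_cut_tensor (cintegrable_sub i1 x1) (cintegrable_sub i2 x1).
have iab := cintegrable_cut_tensor (ial x1) (ibe x1).
have isc : cintegrable mu `[0, x] (fun t => wave (- m) t * sconv s1 s2 x t).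
  exact: cintegrable_wave (cintegrable_shift i0).
split; first exact: isc.
transitivity (cint 0 x (fun t => cint 0 (x - t) (fun xi => al (t + xi) * be xi))).
  apply: ae_eq_cint => //; first exact: cintegrable_meas (cintegrable_shift iab).
  have := ae_cintegrable_shift i0; have aeF := ae_filter_ringOfSetsType mu.
  apply: filterS => t it /it {}it /=; rewrite -cintZ//.
  apply: eq_cint => xi _; rewrite /al /be /twist waveD.
  by rewrite -(mul1r (s1 _ * _)) -(waveN m xi); ring.
rewrite (triangle_shift iab) /=; apply: eq_cint => s /andP[s0 sx].
by rewrite cintZ//; apply: ibe; exact: le_trans sx x1.
Qed.

(** After the substitution [s = t + xi] the oscillating factor is
[wave m s * wave (- m) xi], and the integral over [xi] is the one of
[cint_tensor_shift]. *)
Lemma cint_triple_shift x : x <= 1 ->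
  cintegrable mu `[0, x] (fun t => wave m t * Top s2 (sconv s1 s2) x t) /\
  cint 0 x (fun t => wave m t * Top s2 (sconv s1 s2) x t) =
  cint 0 x (fun s => be s * cint 0 s (fun r => al r * cint 0 r be)).
Proof.
move=> x1; have i0 := isconv x1; have iK := itriple x1.
have iT : cintegrable mu `[0, x] (fun t => wave m t * Top s2 (sconv s1 s2) x t).
  exact: cintegrable_wave (cintegrable_shift i0).
split; first exact: iT.
transitivity (cint 0 x (fun t => cint 0 (x - t) (fun xi =>
    wave m (t + xi - xi) * (s2 (t + xi) * sconv s1 s2 (t + xi) xi)))).
  apply: ae_eq_cint => //; first exact: cintegrable_meas (cintegrable_shift iK).
  have := ae_cintegrable_shift i0; have aeF := ae_filter_ringOfSetsType mu.
  apply: filterS => t it /it {}it /=; rewrite /Top -cintZ//.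
  by apply: eq_cint => xi _; rewrite addrK.
rewrite (triangle_shift iK) /=; apply: eq_cint => s /andP[s0 sx].
have s1' := le_trans sx x1.
have [isc <-] := cint_tensor_shift s1'.
rewrite -cintZ//; apply: eq_cint => xi _.
have -> : wave m (s - xi) = wave m s * wave (- m) xi.
  by rewrite waveD; congr (_ * _); congr cexp; rewrite raddfN /=; ring.
by rewrite /be /twist /=; ring.
Qed.

End Iterates.

(** * Continuous functions on the unit interval *)

Section Continuous01.
Context (R : realType).
Notation mu := (@lebesgue_measure R).
Implicit Types f g : R -> R[i].

(** The condition that [in_MC01] imposes on each entry. *)
Definition ccont01 f : Prop :=
  {within `[0%R, 1%R], continuous (fun x => complex.Re (f x))} /\
  {within `[0%R, 1%R], continuous (fun x => complex.Im (f x))}.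

Lemma ccont01_cst (c : R[i]) : ccont01 (fun=> c).
Proof. by split => x; exact: cst_continuous. Qed.

Lemma eq_within (A : set R) (h k : R -> R) : h =1 k ->
  {within A, continuous h} -> {within A, continuous k}.
Proof. by move=> /funext ->. Qed.

Lemma withinD (A : set R) (a b : R -> R) : {within A, continuous a} ->
  {within A, continuous b} -> {within A, continuous (fun x => a x + b x)}.
Proof. by move=> ca cb x; apply: cvgD; [exact: ca|exact: cb]. Qed.

Lemma withinN (A : set R) (a : R -> R) : {within A, continuous a} ->
  {within A, continuous (fun x => - a x)}.
Proof. by move=> ca x; apply: cvgN; exact: ca. Qed.

Lemma withinM (A : set R) (a b : R -> R) : {within A, continuous a} ->
  {within A, continuous b} -> {within A, continuous (fun x => a x * b x)}.
Proof. by move=> ca cb x; apply: cvgM; [exact: ca|exact: cb]. Qed.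

Lemma ccont01D f g : ccont01 f -> ccont01 g -> ccont01 (fun x => f x + g x).
Proof.
move=> [f1 f2] [g1 g2]; split.
- by apply: (eq_within (fun x => esym (ReD (f x) (g x)))); exact: withinD.
- by apply: (eq_within (fun x => esym (ImD (f x) (g x)))); exact: withinD.
Qed.

Lemma ccont01N f : ccont01 f -> ccont01 (fun x => - f x).
Proof.
move=> [f1 f2]; split.
- by apply: (eq_within (fun x => esym (ReN (f x)))); exact: withinN.
- by apply: (eq_within (fun x => esym (ImN (f x)))); exact: withinN.
Qed.

Lemma ccont01M f g : ccont01 f -> ccont01 g -> ccont01 (fun x => f x * g x).
Proof.
move=> [f1 f2] [g1 g2]; split.
- apply: (eq_within (fun x => esym (ReM (f x) (g x)))).
  by apply: withinD; [exact: withinM|apply: withinN; exact: withinM].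
- apply: (eq_within (fun x => esym (ImM (f x) (g x)))).
  by apply: withinD; exact: withinM.
Qed.

Lemma eq_ccont01 f g : (forall x, 0 <= x <= 1 -> f x = g x) -> ccont01 f -> ccont01 g.
Proof.
move=> fg [f1 f2]; split.
- apply: subspace_eq_continuous f1 => x; rewrite inE /= in_itv /= => /fg E.
  by rewrite /from_subspace E.
- apply: subspace_eq_continuous f2 => x; rewrite inE /= in_itv /= => /fg E.
  by rewrite /from_subspace E.
Qed.

Lemma ccont01_derivable f f' : (forall x, is_cderive f x (f' x)) -> ccont01 f.
Proof.
move=> df; split; apply: continuous_subspaceT => x.
- by have [[h _] _] := df x; apply: differentiable_continuous; exact/derivable1_diffP.
- by have [_ [h _]] := df x; apply: differentiable_continuous; exact/derivable1_diffP.
Qed.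

Lemma ccont01_cint f : cintegrable mu `[0, 1] f -> ccont01 (fun x => cint 0 x f).
Proof. by move=> [f1 f2]; split; exact: parameterized_integral_continuous. Qed.

Lemma ccont01_cmeasurable f : ccont01 f -> cmeasurable (`[0, 1]%classic : set R) f.
Proof. by move=> [f1 f2]; split; exact: subspace_continuous_measurable_fun. Qed.

Lemma ccont01_cabs f : ccont01 f -> {within `[0%R, 1%R], continuous (fun x => cabs (f x))}.
Proof.
move=> [f1 f2]; apply: (eq_within (fun x => esym (cabsE (f x)))) => x.
have c2 : {within `[0%R, 1%R], continuous
    (fun x => complex.Re (f x) * complex.Re (f x) + complex.Im (f x) * complex.Im (f x))}.
  by apply: withinD; exact: withinM.
exact: (continuous_comp (c2 x) (@sqrt_continuous _ _)).
Qed.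

Lemma ccont01_bounded f : ccont01 f ->
  exists M : R, forall x, 0 <= x <= 1 -> cabs (f x) <= M.
Proof.
move=> /ccont01_cabs cf; have [c _ cM] := EVT_max ler01 cf.
by exists (cabs (f c)) => x x01; apply: cM; rewrite in_itv.
Qed.

Lemma ccont01_cintegrableM f g x : x <= 1 -> cintegrable mu `[0, 1] f -> ccont01 g ->
  cintegrable mu `[0, x] (fun t => f t * g t).
Proof.
move=> x1 fi gc; have [M gM] := ccont01_bounded gc.
have H : cintegrable mu `[0, 1] (fun t => g t * f t).
  by apply: (cintegrable_bounded _ fi (ccont01_cmeasurable gc)) => //; exact: gM.
by apply: (eq_cintegrable _ _ (cintegrable_sub H x1)) => // t _; exact: mulrC.
Qed.

Lemma abs_continuous01_ccont01 f : abs_continuous01 f -> ccont01 f.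
Proof.
move=> acf.
have main (g : R -> R) : ac01 g -> {within `[0%R, 1%R], continuous g}.
  move=> acg; apply/subspace_continuousP => x; rewrite /= in_itv /= => /andP[x0 x1].
  apply/cvgrPdist_lt => e e0; have [r r0 gr] := acg e e0.
  exists r => //= y yr; rewrite in_itv /= => /andP[y0 y1].
  move: yr; rewrite /ball_ /=; have [xy|/ltW yx] := leP x y.
    rewrite distrC (distrC (g x)) ger0_norm ?subr_ge0// => yr.
    have := gr [:: (x, y)]; rewrite !big_seq1; apply => //.
    by split => //=; rewrite x0 xy y1.
  rewrite ger0_norm ?subr_ge0// => yr.
  have := gr [:: (y, x)]; rewrite !big_seq1; apply => //.
  by split => //=; rewrite y0 yx x1.
split; apply: main; [exact: abs_continuous01_Re|exact: abs_continuous01_Im].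
Qed.

End Continuous01.

(** * A Gronwall inequality with an integrable weight *)

Section Gronwall.
Context (R : realType).
Notation mu := (@lebesgue_measure R).

Lemma integrable_bounded (D : set (measurableTypeR R)) (h g : R -> R) (M : R) : measurable D ->
  mu.-integrable D (EFin \o h) -> measurable_fun D g ->
  (forall x, D x -> `|g x| <= M) -> mu.-integrable D (EFin \o (fun x => h x * g x)).
Proof.
move=> mD ih mg gM.
have iM : mu.-integrable D (fun x => M%:E * `|(h x)%:E|)%E.
  by apply: integrableZl => //; exact: integrable_abse.
apply: le_integrable iM => //.
- have /integrableP[/measurable_EFinP mh _] := ih.
  by apply/measurable_EFinP; exact: measurable_funM.
- move=> x Dx /=; rewrite lee_fin normrM normrM normr_id mulrC.
  by rewrite ler_wpM2r// (le_trans (gM x Dx))// ler_norm.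
Qed.

Lemma integrable_EFinD (D : set (measurableTypeR R)) (h g : R -> R) : measurable D ->
  mu.-integrable D (EFin \o h) -> mu.-integrable D (EFin \o g) ->
  mu.-integrable D (EFin \o (fun x => h x + g x)).
Proof. by move=> mD ih ig; exact: (integrableD mD ih ig). Qed.

Lemma integrable_EFinZ (D : set (measurableTypeR R)) (h : R -> R) (k : R) : measurable D ->
  mu.-integrable D (EFin \o h) -> mu.-integrable D (EFin \o (fun x => k * h x)).
Proof. by move=> mD ih; exact: (integrableZl mD k ih). Qed.

Lemma le_Rintegral_subset (A B : set (measurableTypeR R)) (h : R -> R) : measurable A -> measurable B ->
  A `<=` B -> mu.-integrable B (EFin \o h) -> (forall x, B x -> 0 <= h x) ->
  \int[mu]_(x in A) h x <= \int[mu]_(x in B) h x.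
Proof.
move=> mA mB AB ih h0; have ihA := integrableS mB mA AB ih.
rewrite /Rintegral; apply: fine_le; [exact: integrable_fin_num ihA|exact: integrable_fin_num ih|].
apply: ge0_subset_integral => //.
by have /integrableP[] := ih.
Qed.

(** Let [m] be the maximum of [phi x = rho x * e^{-lam x}], attained at [z].  In the inequality
for [rho z], multiplied by [e^{-lam z}], the integral is at most [m] times the integral of
[h t * e^{-lam (z - t)}], and this is at most [1/2]: near [z] by the absolute continuity of
the integral of [h], farther away by the size of [lam].  Hence [m <= K + m / 2].  The
constant depends on [h] only. *)
Lemma gronwall_L1 (h : R -> R) : mu.-integrable `[0, 1] (EFin \o h) ->
  (forall x, 0 <= x <= 1 -> 0 <= h x) ->
  exists2 C : R, 0 < C & forall (rho : R -> R) (K : R),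
    {within `[0%R, 1%R], continuous rho} ->
    (forall x, 0 <= x <= 1 -> 0 <= rho x) -> 0 <= K ->
    (forall x, 0 <= x <= 1 -> rho x <= K + \int[mu]_(t in `[0, x]) (h t * rho t)) ->
    forall x, 0 <= x <= 1 -> rho x <= C * K.
Proof.
move=> ih h0.
pose h1 := h \_ `[0, 1].
have ih1 : mu.-integrable setT (EFin \o h1).
  rewrite /h1 -restrict_EFin; apply/integrable_restrict => //.
  by rewrite setTI.
have e40 : 0 < 4^-1 :> R by rewrite invr_gt0.
have [dl [dl0 small]] := integral_normr_continuous ih1 e40.
pose H := \int[mu]_(t in `[0, 1]) h t.
have H0 : 0 <= H by apply: Rintegral_ge0 => t /=; rewrite in_itv; exact: h0.
(* half of [dl], because [small] asks for a measure strictly below [dl] *)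
pose dl2 := dl / 2.
have dl20 : 0 < dl2 by rewrite divr_gt0.
(* makes [expR (lam * dl2)] at least [4 * H], through [1 + x <= expR x] *)
pose lam := 4 * H / dl2.
have lam0 : 0 <= lam by rewrite divr_ge0 ?mulr_ge0// ltW.
have expH : expR (- (lam * dl2)) * H <= 4^-1.
  rewrite /lam divfK ?gt_eqF// expRN mulrC ler_pdivrMr ?expR_gt0//.
  rewrite ler_pdivlMl// (le_trans _ (expR_ge1Dx _))// ?lerDr//.
exists (2 * expR lam); first by rewrite mulr_gt0 ?expR_gt0.
move=> rho K crho rho0 K0 Hrho.
pose phi x := rho x * expR (- lam * x).
have cphi : {within `[0%R, 1%R], continuous phi}.
  apply: withinM => //; apply: continuous_subspaceT => x.
  exact: (continuous_comp (@mulrl_continuous _ (- lam) x) (@continuous_expR _ _)).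
have [z z01 phimax] := EVT_max ler01 cphi.
have zb : 0 <= z <= 1 by move: z01; rewrite in_itv.
have [z0 z1] := andP zb.
have sub01 x : 0 <= x <= z -> 0 <= x <= 1.
  by move=> /andP[-> xz]; rewrite (le_trans xz).
set m := phi z in phimax *.
have m0 : 0 <= m by rewrite mulr_ge0 ?expR_ge0 ?rho0.
have ihz : mu.-integrable `[0, z] (EFin \o h).
  by apply: integrableS ih => //; apply: subset_itvl; rewrite bnd_simp.
have mrho : measurable_fun (`[0, 1]%classic : set R) rho by exact: subspace_continuous_measurable_fun.
have [c _ rhoM] := EVT_max ler01 crho.
have ihrho : mu.-integrable `[0, z] (EFin \o (fun t => h t * rho t)).
  apply: (@integrable_bounded _ _ _ (rho c)) => //.
    by apply: measurable_funS mrho => //; apply: subset_itvl; rewrite bnd_simp.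
  move=> t /=; rewrite in_itv => /sub01 t01; rewrite ger0_norm ?rho0//.
  by apply: rhoM; rewrite in_itv.
pose near1 t : R := if z - dl2 <= t then 1 else 0.
have mnear1 (D : set (measurableTypeR R)) : measurable_fun D near1.
  apply: measurable_funTS; apply: measurable_fun_ifT => //.
  exact: measurable_fun_ler.
have inear : mu.-integrable `[0, z] (EFin \o (fun t => h t * near1 t)).
  apply: (integrable_bounded (M := 1) _ ihz (mnear1 _)) => // t _; rewrite /near1.
  by case: ifP; rewrite ?normr1 ?normr0.
have ifar : mu.-integrable `[0, z] (EFin \o (fun t => h t * expR (- (lam * dl2)))).
  apply: (@integrable_bounded _ _ (fun=> _) (expR (- (lam * dl2)))) => //.
  by move=> t _; rewrite ger0_norm ?expR_ge0.
have half : m <= K + m * (4^-1 + 4^-1).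
  apply: (@le_trans _ _ ((K + \int[mu]_(t in `[0, z]) (h t * rho t)) * expR (- lam * z))).
    by rewrite /m /phi ler_wpM2r ?expR_ge0 ?Hrho.
  rewrite mulrDl lerD//.
    by rewrite ler_piMr// -expR0 ler_expR mulNr oppr_le0 mulr_ge0.
  rewrite mulrC -RintegralZl//.
  have isum : mu.-integrable `[0, z]
      (EFin \o (fun t => h t * near1 t + h t * expR (- (lam * dl2)))).
    exact: integrable_EFinD.
  apply: (@le_trans _ _ (\int[mu]_(t in `[0, z])
      (m * (h t * near1 t + h t * expR (- (lam * dl2)))))).
    apply: le_Rintegral => //.
    + exact: integrable_EFinZ.
    + exact: integrable_EFinZ.
    move=> t /=; rewrite in_itv => tz; have t01 := sub01 _ tz; have [t0 tz'] := andP tz.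
    have pm : rho t * expR (- lam * t) <= m by apply: phimax; rewrite in_itv.
    have -> : expR (- lam * z) * (h t * rho t) =
        h t * (rho t * expR (- lam * t)) * expR (- (lam * (z - t))).
      have -> : - lam * z = - lam * t - lam * (z - t) by ring.
      by rewrite expRD; ring.
    (* the weight is at most [1] within distance [dl2] of [z], and decays beyond it *)
    have dec : expR (- (lam * (z - t))) <= near1 t + expR (- (lam * dl2)).
      rewrite /near1; case: (leP (z - dl2) t) => tn.
        rewrite (@le_trans _ _ 1) ?lerDl ?expR_ge0//.
        by rewrite -expR0 ler_expR oppr_le0 mulr_ge0 ?subr_ge0.
      by rewrite add0r ler_expR lerN2 ler_wpM2l// lerBrDr -lerBrDl ltW.
    rewrite -mulrDr [leRHS]mulrA; apply: ler_pM => //.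
    + by rewrite mulr_ge0 ?h0// mulr_ge0 ?rho0 ?expR_ge0.
    + by rewrite (mulrC m) ler_wpM2l ?h0.
  rewrite RintegralZl// ler_wpM2l// RintegralD// lerD//.
    apply/ltW; apply: le_lt_trans (small (`[0, z] `&` `[z - dl2, z]) _ _).
    - rewrite Rintegral_mkcondr le_eqVlt; apply/orP; left; apply/eqP.
      apply: eq_Rintegral => t /=; rewrite mem_setE => tz.
      have {}tz : 0 <= t <= z by move: tz; rewrite in_itv.
      have t01 := sub01 _ tz; have [t0 tz'] := andP tz.
      rewrite patchE mem_setE in_itv /= tz' andbT /near1.
      case: ifP => _; last by rewrite mulr0.
      by rewrite mulr1 /h1 patchE mem_setE in_itv /= t01 ger0_norm ?h0.
    - exact: measurableI.
    - apply: (@le_lt_trans _ _ (mu `[z - dl2, z])).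
        by apply: le_measure; rewrite ?inE//; exact: measurableI.
      rewrite lebesgue_measure_itv /= lte_fin gtrDl oppr_lt0 dl20 -EFinB lte_fin.
      by rewrite opprB addrCA subrr addr0 /dl2 ltr_pdivrMr// ltr_pMr// ltr1n.
  rewrite RintegralZr// mulrC (le_trans _ expH)// ler_wpM2l ?expR_ge0//.
  apply: le_Rintegral_subset => //.
have m2K : m <= 2 * K by lra.
move=> x x01; have : phi x <= m by apply: phimax; rewrite in_itv.
rewrite /phi => px; have [x0 x1] := andP x01.
have -> : rho x = rho x * expR (- lam * x) * expR (lam * x).
  by rewrite -mulrA -expRD mulNr addNr expR0 mulr1.
have -> : 2 * expR lam * K = 2 * K * expR lam by ring.
apply: ler_pM.
- by rewrite mulr_ge0 ?rho0 ?expR_ge0.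
- exact: expR_ge0.
- exact: le_trans px m2K.
- by rewrite ler_expR ler_piMr.
Qed.

End Gronwall.

(** * The Volterra system and its third iterate *)

Section Volterra.
Context (R : realType).
Notation mu := (@lebesgue_measure R).
Variables al be u v : R -> R[i].
Hypothesis ial : cintegrable mu `[0, 1] al.
Hypothesis ibe : cintegrable mu `[0, 1] be.
Hypothesis cu : ccont01 u.
Hypothesis cv : ccont01 v.
Hypothesis uE : forall x, 0 <= x <= 1 -> u x = 1 - cint 0 x (fun t => al t * v t).
Hypothesis vE : forall x, 0 <= x <= 1 -> v x = - cint 0 x (fun t => be t * u t).

(** Picard iteration of the system from [(1, 0)] yields [1 + iter2 al be] for [u] and
[- iter1 be - iter3 al be] for [v], up to terms of higher order. *)
Definition iter1 (b : R -> R[i]) (x : R) := cint 0 x b.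
Definition iter2 (a b : R -> R[i]) (x : R) := cint 0 x (fun t => a t * iter1 b t).
Definition iter3 (a b : R -> R[i]) (x : R) := cint 0 x (fun t => b t * iter2 a b t).

Local Notation B := (iter1 be).
Local Notation F := (iter2 al be).
Local Notation G := (iter3 al be).

Let cB : ccont01 B. Proof. exact: ccont01_cint. Qed.

Let iM f g x : x <= 1 -> cintegrable mu `[0, 1] f -> ccont01 g ->
  cintegrable mu `[0, x] (fun t => f t * g t).
Proof. exact: ccont01_cintegrableM. Qed.

Let cF : ccont01 F. Proof. by apply: ccont01_cint; exact: iM. Qed.

Let cG : ccont01 G. Proof. by apply: ccont01_cint; exact: iM. Qed.

Let mitv (b : R) : measurable (`[0, b]%classic : set (measurableTypeR R)).
Proof. exact: measurable_itv. Qed.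

Let r x := u x - 1 - F x.
Let w x := v x + B x + G x.

Let cr : ccont01 r.
Proof. by apply: ccont01D; [apply: ccont01D => //; exact: ccont01_cst|exact: ccont01N]. Qed.

Let cw : ccont01 w.
Proof. by apply: ccont01D => //; exact: ccont01D. Qed.

Let le01 (x : R) : 0 <= x <= 1 -> x <= 1. Proof. by case/andP. Qed.

Lemma remainder_rE x : 0 <= x <= 1 ->
  r x = cint 0 x (fun t => al t * G t) - cint 0 x (fun t => al t * w t).
Proof.
move=> x01; have x1 := le01 x01.
rewrite /r (uE x01) /iter2.
have -> : cint 0 x (fun t => al t * v t) = cint 0 x (fun t => al t * w t) -
    cint 0 x (fun t => al t * B t) - cint 0 x (fun t => al t * G t).
  rewrite -cintB; [|exact: iM|exact: iM].
  rewrite -cintB; [|by apply: cintegrableB => //; exact: iM|exact: iM].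
  by apply: eq_cint => t _; rewrite /w; ring.
move: (cint 0 x (fun t => al t * w t)) (cint 0 x (fun t => al t * B t))
  (cint 0 x (fun t => al t * G t)) => X Y Z.
by ring.
Qed.

Lemma remainder_wE x : 0 <= x <= 1 -> w x = - cint 0 x (fun t => be t * r t).
Proof.
move=> x01; have x1 := le01 x01.
rewrite /w (vE x01) /iter3 [B x]/iter1.
have -> : cint 0 x (fun t => be t * u t) = cint 0 x (fun t => be t * r t) +
    cint 0 x be + cint 0 x (fun t => be t * F t).
  have ibx := cintegrable_sub ibe x1.
  rewrite -cintD; [|exact: iM|exact: ibx].
  rewrite -cintD; [|by apply: cintegrableD => //; exact: iM|exact: iM].
  by apply: eq_cint => t _; rewrite /r; ring.
move: (cint 0 x (fun t => be t * r t)) (cint 0 x be)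
  (cint 0 x (fun t => be t * F t)) => X Y Z.
by ring.
Qed.

(** Exchanging the two integrations leaves the integral of [be] over [[t, x]], which is
[B x - B t].  Both resulting terms contain [B] twice, and this is what makes the final
estimate quadratic in the Fourier integrals of the potentials. *)
Lemma iter3E x : 0 <= x <= 1 ->
  G x = B x * F x - cint 0 x (fun t => al t * B t * B t).
Proof.
move=> x01; have x1 := le01 x01; have [x0 _] := andP x01.
have iab := iM (lexx 1) ial cB.
have icut := cintegrable_cut_tensor (cintegrable_sub ibe x1) (cintegrable_sub iab x1).
have := triangle_swap icut; rewrite /= => E.
have -> : G x = cint 0 x (fun s => cint 0 s (fun xi => be s * (al xi * B xi))).
  apply: eq_cint => t /andP[t0 tx].
  by rewrite (cintZ (be t) (cintegrable_sub iab (le_trans tx x1))).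
rewrite E.
have -> : B x * F x = cint 0 x (fun t => B x * (al t * B t)).
  by rewrite (cintZ (B x) (cintegrable_sub iab x1)).
rewrite -cintB.
- apply: eq_cint => t /andP[t0 tx].
  have -> : cint t x (fun s => be s * (al t * B t)) = (al t * B t) * (B x - B t).
    have ibt := cintegrable_sub_left t0 (cintegrable_sub ibe x1).
    rewrite -[B x - B t](cint_split t0 tx x1 ibe) -(cintZ (al t * B t) ibt).
    by apply: eq_cint => s _; ring.
  by ring.
- by have H := cintegrable_sub iab x1; apply: cintegrableZ H.
- exact: (iM x1 iab cB).
Qed.

Let Q := \int[mu]_(t in `[0, 1]) (cabs (al t) * cabs (B t)).
Let P := \int[mu]_(t in `[0, 1]) (cabs (al t) * cabs (B t) ^+ 2).
Let a := \int[mu]_(t in `[0, 1]) cabs (al t).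

Lemma le_iter2 x : 0 <= x <= 1 -> cabs (F x) <= Q.
Proof.
move=> x01; have x1 := le01 x01.
apply: (le_trans (le_cabs_cint (iM x1 ial cB))).
have -> : Q = \int[mu]_(t in `[0, 1]) cabs (al t * B t).
  by apply: eq_Rintegral => t _; rewrite cabsM.
apply: le_Rintegral_subset => //; last by move=> t _; exact: cabs_ge0.
- by apply: subset_itvl; rewrite bnd_simp.
- exact: (cintegrable_cabs (mitv _) (iM (lexx 1) ial cB)).
Qed.

(** By [iter3E], [|G|] is at most [Q |B| + P]; integrating this against [|al|] gives the
bound. *)
Lemma le_cint_iter3 x : 0 <= x <= 1 ->
  cabs (cint 0 x (fun t => al t * G t)) <= Q ^+ 2 + a * P.
Proof.
move=> x01; have x1 := le01 x01.
have iab := iM (lexx 1) ial cB.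
have iabb := iM (lexx 1) iab cB.
have icab := cintegrable_cabs (mitv _) iab.
have icabb := cintegrable_cabs (mitv _) iabb.
have ica := cintegrable_cabs (mitv _) ial.
have iQ : mu.-integrable `[0, 1] (EFin \o (fun t => Q * cabs (al t * B t))).
  exact: integrable_EFinZ.
have iP : mu.-integrable `[0, 1] (EFin \o (fun t => P * cabs (al t))).
  exact: integrable_EFinZ.
have iQP := integrable_EFinD (mitv _) iQ iP.
apply: (@le_trans _ _ (\int[mu]_(t in `[0, 1]) (Q * cabs (al t * B t) + P * cabs (al t)))); last first.
  rewrite RintegralD// RintegralZl// RintegralZl// -/a (mulrC P) lerD2r.
  by under eq_Rintegral do rewrite cabsM.
have iaG := iM (lexx 1) ial cG.
have icaG := cintegrable_cabs (mitv _) iaG.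
apply: (le_trans (le_cabs_cint (cintegrable_sub iaG x1))).
apply: (@le_trans _ _ (\int[mu]_(t in `[0, 1]) cabs (al t * G t))).
  apply: le_Rintegral_subset => //; last by move=> t _; exact: cabs_ge0.
  by apply: subset_itvl; rewrite bnd_simp.
apply: le_Rintegral => // t; rewrite /= in_itv => t01; have [t0 t1] := andP t01.
rewrite (iter3E t01) cabsM.
have -> : Q * cabs (al t * B t) + P * cabs (al t) = cabs (al t) * (cabs (B t) * Q + P).
  by rewrite cabsM; ring.
rewrite ler_wpM2l ?cabs_ge0// (le_trans (le_cabsB _ _))// lerD//.
  by rewrite cabsM ler_wpM2l ?cabs_ge0// le_iter2.
apply: (le_trans (le_cabs_cint (cintegrable_sub iabb t1))).
apply: (@le_trans _ _ (\int[mu]_(t in `[0, 1]) cabs (al t * B t * B t))).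
  apply: le_Rintegral_subset => //; last by move=> y _; exact: cabs_ge0.
  by apply: subset_itvl; rewrite bnd_simp.
by under eq_Rintegral do rewrite !cabsM -mulrA -expr2.
Qed.

Variable h : R -> R.
Hypothesis ih : mu.-integrable `[0, 1] (EFin \o h).
Hypothesis alh : forall t, 0 <= t <= 1 -> cabs (al t) <= h t.
Hypothesis beh : forall t, 0 <= t <= 1 -> cabs (be t) <= h t.

(** The inhomogeneous term [int al G] is bounded by [le_cint_iter3]; the two others couple [r]
and [w], and adding the equations closes the inequality for [|r| + |w|]. *)
Lemma remainder_integral_ineq x : 0 <= x <= 1 ->
  cabs (r x) + cabs (w x) <= Q ^+ 2 + a * P +
    \int[mu]_(t in `[0, x]) (h t * (cabs (r t) + cabs (w t))).
Proof.
move=> x01; have x1 := le01 x01.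
have iaw := iM x1 ial cw; have ibr := iM x1 ibe cr.
have icaw := cintegrable_cabs (mitv _) iaw.
have icbr := cintegrable_cabs (mitv _) ibr.
have ihx : mu.-integrable `[0, x] (EFin \o h).
  by apply: integrableS ih => //; apply: subset_itvl; rewrite bnd_simp.
rewrite (remainder_rE x01) (remainder_wE x01) cabsN.
apply: (@le_trans _ _ (Q ^+ 2 + a * P + (\int[mu]_(t in `[0, x]) cabs (al t * w t) +
    \int[mu]_(t in `[0, x]) cabs (be t * r t)))).
  rewrite addrA lerD//; last exact: le_cabs_cint.
  by rewrite (le_trans (le_cabsB _ _))// lerD//; [exact: le_cint_iter3|exact: le_cabs_cint].
rewrite lerD2l -RintegralD//; apply: le_Rintegral => //.
- exact: integrable_EFinD.
- have crho := withinD (ccont01_cabs cr) (ccont01_cabs cw).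
  have mrho := subspace_continuous_measurable_fun (measurable_itv _) crho.
  have [c _ cM] := EVT_max ler01 crho.
  have : mu.-integrable `[0, 1] (EFin \o (fun t => h t * (cabs (r t) + cabs (w t)))).
    apply: (integrable_bounded (mitv _) ih mrho) => t /= t01.
    by rewrite ger0_norm ?addr_ge0 ?cabs_ge0//; exact: cM.
  by apply: integrableS => //; apply: subset_itvl; rewrite bnd_simp.
move=> t; rewrite /= in_itv /= => /andP[t0 tx].
have t01 : 0 <= t <= 1 by rewrite t0 (le_trans tx).
rewrite !cabsM mulrDr addrC lerD// ler_wpM2r ?cabs_ge0//; [exact: beh|exact: alh].
Qed.

End Volterra.

(** * Hoelder's inequality on the unit interval *)

Section Hoelder01.
Context (R : realType).
Notation mu := (@lebesgue_measure R).
Notation I01 := (`[0%R, 1%R]%classic : set (measurableTypeR R)).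
Implicit Types (s f : R -> R[i]) (p : R).

Let ext f : measurableTypeR R -> R := (fun x => cabs (f x)) \_ I01.

Let extE f : (fun x => (cabs (f x))%:E) \_ I01 = EFin \o ext f.
Proof. exact: restrict_EFin. Qed.

Let ext_ge0 f x : 0 <= ext f x.
Proof. by rewrite /ext patchE; case: ifP => // _; exact: cabs_ge0. Qed.

Let mext f : cmeasurable I01 f -> measurable_fun [set: measurableTypeR R] (ext f).
Proof. by move=> mf; apply/(measurable_restrictT _ _).1 => //; exact: cmeasurable_cabs. Qed.

Lemma Lnorm01E q f : Lnorm01 q f = Lnorm mu q (EFin \o ext f).
Proof. by rewrite /Lnorm01 -extE. Qed.

Lemma Lnorm01_ge0 q f : (0 <= Lnorm01 q f)%E.
Proof. exact: Lnorm_ge0. Qed.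

Lemma Lnorm01_1 s : Lnorm01 1 s = (\int[mu]_(x in `[0%R, 1%R]) (cabs (s x))%:E)%E.
Proof.
rewrite Lnorm01E Lnorm1 [RHS]integral_mkcond extE.
by apply: eq_integral => x _ /=; rewrite ger0_norm ?ext_ge0.
Qed.

Lemma integral_mul_ext s f :
  (\int[mu]_(x in `[0%R, 1%R]) (cabs (s x) * cabs (f x))%:E =
   \int[mu]_x `|(ext s x * ext f x)%:E|)%E.
Proof.
rewrite integral_mkcond; apply: eq_integral => x _.
rewrite /ext !patchE; case: ifP => _; last by rewrite mul0r /= normr0.
by rewrite /= ger0_norm// mulr_ge0 ?cabs_ge0.
Qed.

Let mu01 : mu I01 = 1%E.
Proof. by rewrite lebesgue_measure_itv /= lte_fin ltr01 -EFinB subr0. Qed.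

Lemma conjugate_cases p (q : \bar R) : 1 <= p -> ((p%:E)^-1 + q^-1 = 1)%E ->
  p = 1 /\ q = +oo%E \/
  exists q' : R, [/\ q = q'%:E, 0 < p, 0 < q' & p^-1 + q'^-1 = 1].
Proof.
move=> p1 pq; have p0 : 0 < p by rewrite (lt_le_trans ltr01).
have /hoelder_conjugateP qE := pq.
have {qE} -> : q = hoelder_conjugate p%:E by apply: qE; rewrite ?ltNyr// eqe gt_eqF.
have [->|pn1] := eqVneq p 1; first by left; rewrite hoelder_conjugate1.
have p1' : 0 < p - 1 by rewrite subr_gt0 lt_neqAle eq_sym pn1.
right; exists (p / (p - 1)); split => //.
- by rewrite /hoelder_conjugate/= eqe gt_eqF// -EFinD inver gt_eqF// -EFinM.
- by rewrite divr_gt0.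
- by rewrite invf_div; field; rewrite gt_eqF.
Qed.

(** At the endpoint [p = 1] the second norm is an essential supremum, and the inequality
between the integrands holds almost everywhere. *)
Lemma hoelder01 p (q : \bar R) s f : 1 <= p -> ((p%:E)^-1 + q^-1 = 1)%E ->
  cmeasurable I01 s -> cmeasurable I01 f ->
  (\int[mu]_(x in `[0%R, 1%R]) (cabs (s x) * cabs (f x))%:E <=
   Lnorm01 p%:E s * Lnorm01 q f)%E.
Proof.
move=> p1 /(conjugate_cases p1) pq ms mf; rewrite integral_mul_ext.
case: pq => [[-> ->]|[q' [-> p0 q0 pq]]]; last first.
  have := hoelder mu (mext ms) (mext mf) p0 q0 pq.
  by rewrite Lnorm1 !Lnorm01E.
rewrite Lnorm01E Lnorm1 Lnorm01E.
have muT : (0 < mu [set: measurableTypeR R])%E.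
  by apply: (@lt_le_trans _ _ (mu I01)); [rewrite mu01|apply: le_measure; rewrite ?inE].
have -> : Lnorm mu +oo (EFin \o ext f) = ess_sup mu (abse \o (EFin \o ext f)).
  by rewrite unlock muT.
set N := ess_sup mu _.
have fN : (\forall x \ae mu, `|(ext f x)%:E| <= N)%E by exact: ess_sup_ge.
have N0 : (0 <= N)%E by apply: ess_sup_gee => //; apply: nearW => x /=.
have me : measurable_fun setT (fun x => `|(ext s x)%:E|%E).
  by apply/measurable_EFinP/measurableT_comp => //; exact: mext.
rewrite -ge0_integralZr//.
apply: ae_ge0_le_integral => //.
- apply/measurable_EFinP/measurableT_comp => //.
  by apply: measurable_funM; exact: mext.
- by move=> x _; rewrite mule_ge0.
- exact: emeasurable_funM.
have aeF := ae_filter_ringOfSetsType mu.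
apply: filterS fN => x fN _.
by rewrite EFinM abseM lee_wpmul2l.
Qed.

(** On an interval of finite length [|s| <= 1 + |s|^p] is enough. *)
Lemma in_Lp01_cintegrable p s : 1 <= p -> in_Lp01 p s -> cintegrable mu I01 s.
Proof.
move=> p1 [m1 m2 Ls]; have p0 : 0 < p by rewrite (lt_le_trans ltr01).
have ms : cmeasurable I01 s by split.
have mI : measurable I01 by [].
apply: (@le_cintegrable _ _ R mu I01 mI s (fun x => 1 + ext s x `^ p)) => //; last first.
  move=> x x01; rewrite /ext patchE mem_set//.
  have [s1|s1] := leP (cabs (s x)) 1; first by rewrite (le_trans s1)// lerDl powR_ge0.
  apply: ler_wpDl => //; rewrite -[leLHS]powRr1 ?cabs_ge0//.
  by rewrite ler_powR// ltW.
apply: integrable_EFinD => //.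
  apply/integrableP; split; first exact: measurable_cst.
  under eq_integral do rewrite /= normr1.
  by rewrite integral_cst// mul1e [X in (X < _)%E]mu01 ltry.
have mps : measurable_fun I01 (fun x => ext s x `^ p).
  apply: (@measurableT_comp _ _ _ _ _ _ (fun y : R => y `^ p)); first exact: measurable_powR.
  by apply: measurable_funTS; exact: mext.
apply/integrableP; split; first exact/measurable_EFinP.
have : (\int[mu]_x (`|(EFin \o ext s) x| `^ p) < +oo)%E.
  by rewrite -poweR_Lnorm ?gt_eqF// -Lnorm01E poweR_lty.
apply: le_lt_trans.
rewrite [leRHS](_ : _ = \int[mu]_x `|(ext s x `^ p)%:E|)%E; last first.
  apply: eq_integral => x _ /=; rewrite (ger0_norm (ext_ge0 _ _)) ger0_norm ?powR_ge0//.
apply: ge0_subset_integral => //.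
apply/measurable_EFinP/measurableT_comp => //.
apply: (@measurableT_comp _ _ _ _ _ _ (fun y : R => y `^ p)); first exact: measurable_powR.
exact: mext.
Qed.

End Hoelder01.

(** * Columns of the solution *)

Section AbsolutelyContinuousAlgebra.
Context (R : realType).
Notation mu := (@lebesgue_measure R).
Implicit Types f g : R -> R[i].

(** The increment of the product is [g(b) (f(b) - f(a)) + (g(b) - g(a)) f(a)], with [f] and
[g] bounded. *)
Lemma abs_continuous01M_lipschitz f g (L : R) : abs_continuous01 f -> ccont01 g ->
  (forall x y, 0 <= x -> x <= y -> y <= 1 -> cabs (g y - g x) <= L * (y - x)) ->
  abs_continuous01 (fun x => g x * f x).
Proof.
move=> acf cg gL e e0.
have [Mf fM] := ccont01_bounded (abs_continuous01_ccont01 acf).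
have [Mg gM] := ccont01_bounded cg.
have i01 : 0 <= (0 : R) <= 1 by rewrite lexx ler01.
have Mf0 : 0 <= Mf := le_trans (cabs_ge0 _) (fM 0 i01).
have Mg0 : 0 <= Mg := le_trans (cabs_ge0 _) (gM 0 i01).
have L0 : 0 <= L.
  have := gL 0 1 (lexx _) ler01 (lexx _); rewrite subr0 mulr1.
  exact/le_trans/cabs_ge0.
have e1 : 0 < e / 2 / (Mg + 1) by rewrite divr_gt0 ?divr_gt0// ltr_wpDl.
have [r r0 fr] := acf _ e1.
have r1 : 0 < e / 2 / (L * Mf + 1) by rewrite !divr_gt0// ltr_wpDl// mulr_ge0.
exists (Num.min r (e / 2 / (L * Mf + 1))); first by rewrite lt_min r0 r1.
move=> n a b ab dis; rewrite lt_min => /andP[sr sr1].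
have Hf := fr n a b ab dis sr.
apply: (@le_lt_trans _ _ (\sum_k (Mg * cabs (f (b k) - f (a k)) + L * Mf * (b k - a k)))).
  apply: ler_sum => k _; have [a0 [abk b1]] := ab k.
  have -> : g (b k) * f (b k) - g (a k) * f (a k) =
    g (b k) * (f (b k) - f (a k)) + (g (b k) - g (a k)) * f (a k) by ring.
  rewrite (le_trans (le_cabsD _ _))// !cabsM lerD//.
    by rewrite ler_wpM2r ?cabs_ge0 ?gM// b1 (le_trans a0).
  have -> : L * Mf * (b k - a k) = L * (b k - a k) * Mf by ring.
  rewrite ler_pM ?cabs_ge0//; first exact: gL.
  by rewrite fM// a0 (le_trans abk).
rewrite big_split /= -!mulr_sumr [e]splitr.
have S0 : 0 <= \sum_k (b k - a k).
  by apply: sumr_ge0 => k _; rewrite subr_ge0; have [_ []] := ab k.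
have T0 : 0 <= \sum_k cabs (f (b k) - f (a k)) by apply: sumr_ge0 => k _; exact: cabs_ge0.
rewrite ltr_leD//.
  rewrite (@le_lt_trans _ _ ((Mg + 1) * \sum_k cabs (f (b k) - f (a k))))//.
    by rewrite ler_wpM2r// lerDl.
  by rewrite mulrC -ltr_pdivlMr// ltr_wpDl.
rewrite (@le_trans _ _ ((L * Mf + 1) * \sum_k (b k - a k)))//.
  by rewrite ler_wpM2r// lerDl.
by rewrite mulrC -ler_pdivlMr ?ltW// ltr_wpDl// mulr_ge0.
Qed.

Lemma abs_continuous01_ftc f g : abs_continuous01 f -> cintegrable mu `[0, 1] g ->
  {ae mu, forall x : R, x \in `[0%R, 1%R] -> is_cderive f x (g x)} ->
  forall x, 0 <= x <= 1 -> f x = f 0 + cint 0 x g.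
Proof.
move=> acf [g1 g2] dfg x x01; have aeF := ae_filter_ringOfSetsType mu.
apply: ReIm_inj; rewrite ?ReD ?ImD.
- apply: (ac01_ftc (abs_continuous01_Re acf) g1) => //.
  by apply: filterS dfg => y fgy /fgy[].
- apply: (ac01_ftc (abs_continuous01_Im acf) g2) => //.
  by apply: filterS dfg => y fgy /fgy[].
Qed.

End AbsolutelyContinuousAlgebra.

Section Column.
Context (R : realType).
Notation mu := (@lebesgue_measure R).
Implicit Types m : R[i].

Lemma is_cderive_wave m x : is_cderive (wave m) x (2 * 'i%C * m * wave m x).
Proof. exact: is_cderive_cexp. Qed.

Lemma ccont01_wave m : ccont01 (wave m).
Proof. exact: (ccont01_derivable (is_cderive_wave m)). Qed.

Lemma wave0 m : wave m 0 = 1.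
Proof. by rewrite /wave mulr0 cexp0. Qed.

Lemma abs_continuous01_wave m f : abs_continuous01 f ->
  abs_continuous01 (fun x => wave m x * f x).
Proof.
move=> acf.
have [M waveM] := ccont01_bounded (ccont01_wave m).
apply: (@abs_continuous01M_lipschitz _ _ _ (2 * (cabs (2 * 'i%C * m) * M))) => //.
  exact: ccont01_wave.
move=> x y x0 xy y1.
apply: (cabs_mean_value xy (fun t _ => is_cderive_wave m t)) => t.
rewrite in_itv /= => /andP[xt ty]; rewrite cabsM ler_wpM2l ?cabs_ge0//.
by rewrite waveM// (le_trans x0 xt) (le_trans ty y1).
Qed.

Lemma wave_add m m' x : wave m x * wave m' x = wave (m + m') x.
Proof. by rewrite -cexpD; congr cexp; ring. Qed.

Variables (s1 s2 y z : R -> R[i]) (m : R[i]).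
Hypothesis is1 : cintegrable mu `[0, 1] s1.
Hypothesis is2 : cintegrable mu `[0, 1] s2.
Hypothesis acy : abs_continuous01 y.
Hypothesis acz : abs_continuous01 z.
Hypothesis y0 : y 0 = 1.
Hypothesis z0 : z 0 = 0.
Hypothesis ode : {ae mu, forall x : R, x \in `[0%R, 1%R] ->
  is_cderive y x ('i%C * m * y x - s1 x * z x) /\
  is_cderive z x (- ('i%C * m * z x) - s2 x * y x)}.

Let al := twist (- m) s1.
Let be := twist m s2.
Let u x := wave (- (m / 2)) x * y x.
Let v x := wave (m / 2) x * z x.

Let half : m = m / 2 + m / 2.
Proof. by rewrite -mulrDr -[X in _ * X]mulr2n -mulr_natl; field. Qed.

Let ial : cintegrable mu `[0, 1] al. Proof. exact: cintegrable_wave. Qed.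

Let ibe : cintegrable mu `[0, 1] be. Proof. exact: cintegrable_wave. Qed.

Let acu : abs_continuous01 u. Proof. exact: abs_continuous01_wave. Qed.

Let acv : abs_continuous01 v. Proof. exact: abs_continuous01_wave. Qed.

Let cu : ccont01 u. Proof. exact: abs_continuous01_ccont01. Qed.

Let cv : ccont01 v. Proof. exact: abs_continuous01_ccont01. Qed.

Let cint_opp f x : x <= 1 -> cintegrable mu `[0, 1] f ->
  cint 0 x (fun t => - 1 * f t) = - cint 0 x f.
Proof. by move=> x1 fi; rewrite (cintZ (- 1) (cintegrable_sub fi x1)) mulN1r. Qed.

Lemma column_u x : 0 <= x <= 1 -> u x = 1 - cint 0 x (fun t => al t * v t).
Proof.
move=> x01; have [_ x1] := andP x01; have aeF := ae_filter_ringOfSetsType mu.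
have iav : cintegrable mu `[0, 1] (fun t => al t * v t) by exact: ccont01_cintegrableM.
rewrite -(cint_opp x1 iav).
have u0 : u 0 = 1 by rewrite /u wave0 y0 mulr1.
rewrite -[X in _ = X + _]u0.
apply: abs_continuous01_ftc x01 => //.
  by apply: cintegrableZ iav.
apply: filterS ode => t odet /odet[dy _].
apply: is_cderive_eq (is_cderiveM (is_cderive_wave _ _) dy) _.
rewrite /al /v /twist.
have -> : wave (- m) t * s1 t * (wave (m / 2) t * z t) = wave (- (m / 2)) t * (s1 t * z t).
  rewrite (_ : - (m / 2) = - m + m / 2); last by rewrite {2}half opprD addrNK.
  by rewrite -wave_add; move: (wave (- m) t) (wave (m / 2) t) => W W'; ring.
have -> : 2 * 'i%C * - (m / 2) = - ('i%C * m).
  by rewrite [in RHS]half; ring.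
by move: (wave _ _) => W; ring.
Qed.

Lemma column_v x : 0 <= x <= 1 -> v x = - cint 0 x (fun t => be t * u t).
Proof.
move=> x01; have [_ x1] := andP x01; have aeF := ae_filter_ringOfSetsType mu.
have ibu : cintegrable mu `[0, 1] (fun t => be t * u t) by exact: ccont01_cintegrableM.
rewrite -(cint_opp x1 ibu) -[RHS]add0r.
have v0 : v 0 = 0 by rewrite /v z0 mulr0.
rewrite -[X in _ = X + _]v0.
apply: abs_continuous01_ftc x01 => //.
  by apply: cintegrableZ ibu.
apply: filterS ode => t odet /odet[_ dz].
apply: is_cderive_eq (is_cderiveM (is_cderive_wave _ _) dz) _.
rewrite /be /u /twist.
have -> : wave m t * s2 t * (wave (- (m / 2)) t * y t) = wave (m / 2) t * (s2 t * y t).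
  have -> : wave (m / 2) t = wave m t * wave (- (m / 2)) t.
    by rewrite wave_add (_ : m - m / 2 = m / 2)// {1}half addrK.
  by move: (wave m t) (wave _ t) => W W'; ring.
have -> : 2 * 'i%C * (m / 2) = 'i%C * m.
  by rewrite [in RHS]half; ring.
by move: (wave _ _) => W; ring.
Qed.

Variable h : R -> R.
Hypothesis ih : mu.-integrable `[0, 1] (EFin \o h).
Hypothesis alh : forall t, 0 <= t <= 1 -> cabs (al t) <= h t.
Hypothesis beh : forall t, 0 <= t <= 1 -> cabs (be t) <= h t.

(** The Gronwall constant [C] is an argument because it has to be the same for both columns
and for every [m] in the strip. *)
Lemma column_remainder (C : R) :
  (forall (rho : R -> R) (K : R),
    {within `[0%R, 1%R], continuous rho} ->
    (forall x, 0 <= x <= 1 -> 0 <= rho x) -> 0 <= K ->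
    (forall x, 0 <= x <= 1 -> rho x <= K + \int[mu]_(t in `[0, x]) (h t * rho t)) ->
    forall x, 0 <= x <= 1 -> rho x <= C * K) ->
  exists r w : R -> R[i], [/\ ccont01 r, ccont01 w &
    forall x, 0 <= x <= 1 ->
    [/\ y x = wave (m / 2) x * (1 + iter2 al be x + r x),
        z x = wave (- (m / 2)) x * (- iter1 be x - iter3 al be x + w x) &
        cabs (r x) + cabs (w x) <= C *
         ((\int[mu]_(t in `[0, 1]) (cabs (al t) * cabs (iter1 be t))) ^+ 2 +
          \int[mu]_(t in `[0, 1]) cabs (al t) *
          \int[mu]_(t in `[0, 1]) (cabs (al t) * cabs (iter1 be t) ^+ 2))]].
Proof.
move=> gron.
have c1 : ccont01 (iter1 be) by exact: ccont01_cint.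
have c2 : ccont01 (iter2 al be) by apply: ccont01_cint; exact: ccont01_cintegrableM.
have c3 : ccont01 (iter3 al be) by apply: ccont01_cint; exact: ccont01_cintegrableM.
pose r x := u x - 1 - iter2 al be x.
pose w x := v x + iter1 be x + iter3 al be x.
have cr : ccont01 r.
  by apply: ccont01D; [apply: ccont01D => //; exact: ccont01_cst|exact: ccont01N].
have cw : ccont01 w by apply: ccont01D => //; exact: ccont01D.
exists r, w; split => // x x01; split.
- rewrite /r /u [X in _ = _ * X](_ : _ = wave (- (m / 2)) x * y x); last by ring.
  by rewrite mulrA (mulrC (wave _ _)) waveN mul1r.
- rewrite /w /v [X in _ = _ * X](_ : _ = wave (m / 2) x * z x); last by ring.
  by rewrite mulrA waveN mul1r.
apply: (gron (fun x => cabs (r x) + cabs (w x))) x01.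
- by apply: withinD; exact: ccont01_cabs.
- by move=> t _; rewrite addr_ge0 ?cabs_ge0.
- rewrite addr_ge0 ?sqr_ge0// mulr_ge0//; apply: Rintegral_ge0 => t _.
    exact: cabs_ge0.
  by rewrite mulr_ge0 ?sqr_ge0 ?cabs_ge0.
- move=> t t01.
  exact: (remainder_integral_ineq ial ibe cu cv column_u column_v ih alh beh t01).
Qed.

End Column.

(** * The explicit terms as iterates *)

Section FirstIterates.
Context (R : realType).
Notation mu := (@lebesgue_measure R).
Implicit Types m : R[i].

Lemma mexp_Amx m (x : R) :
  mexp (x%:C *: Amx m) = mx2 (wave (m / 2) x) 0 0 (wave (- (m / 2)) x).
Proof.
have -> : x%:C *: Amx m = mx2 (2 * 'i%C * (m / 2) * x%:C) 0 0
    (2 * 'i%C * - (m / 2) * x%:C).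
  have two : 2 * (m / 2) = m by rewrite mulrC divfK// pnatr_eq0.
  apply/matrixP; apply: ord2P; apply: ord2P; rewrite /Amx /J0 2!mxE !mx2E ?mulr0//.
  - by rewrite mulr1 -{1}two; ring.
  - by rewrite -{1}two; ring.
exact: mexp_diag.
Qed.

Lemma wave_reflect m (x t : R) : wave (m / 2) (x - 2 * t) = wave (m / 2) x * wave (- m) t.
Proof.
rewrite -cexpD; congr cexp.
have two : m = 2 * (m / 2) by rewrite mulrC divfK// pnatr_eq0.
rewrite {3}two raddfB /= (_ : (2 * t)%:C = 2 * t%:C); first by ring.
by rewrite rmorphM rmorph_nat.
Qed.

Lemma mx2_diagM (a b c d e f : R[i]) :
  mx2 e 0 0 f *m mx2 a b c d = mx2 (e * a) (e * b) (f * c) (f * d).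
Proof. by rewrite mx2M !mul0r !addr0 !add0r. Qed.

Variables (s1 s2 : R -> R[i]) (m : R[i]).
Hypothesis i1 : cintegrable mu `[0, 1] s1.
Hypothesis i2 : cintegrable mu `[0, 1] s2.

Let al := twist (- m) s1.
Let be := twist m s2.

Lemma cint_sconv_iter2 x : x <= 1 ->
  cint 0 x (fun t => wave (m / 2) (x - 2 * t) * sconv s1 s2 x t) =
  wave (m / 2) x * iter2 al be x.
Proof.
move=> x1; have [isc E] := cint_tensor_shift m i1 i2 x1.
rewrite /iter2 /iter1 -E -(cintZ _ isc); apply: eq_cint => t _.
by rewrite wave_reflect mulrA.
Qed.

Lemma cint_Top_iter3 x : x <= 1 ->
  cint 0 x (fun t => wave (- (m / 2)) (x - 2 * t) * - Top s2 (sconv s1 s2) x t) =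
  wave (- (m / 2)) x * - iter3 al be x.
Proof.
move=> x1; have [isc E] := cint_triple_shift m i1 i2 x1.
rewrite mulrN -mulNr /iter3 /iter2 /iter1 -E -(cintZ _ isc); apply: eq_cint => t _.
by rewrite -mulNr wave_reflect opprK; ring.
Qed.

Lemma cint_s_iter1 x : x <= 1 ->
  cint 0 x (fun t => wave (- (m / 2)) (x - 2 * t) * s2 t) =
  wave (- (m / 2)) x * iter1 be x.
Proof.
move=> x1; have ib : cintegrable mu `[0, x] be.
  by apply: cintegrable_wave => //; exact: cintegrable_sub i2 x1.
rewrite /iter1 -(cintZ _ ib); apply: eq_cint => t _.
by rewrite -mulNr wave_reflect mulNr opprK /be /twist mulrA.
Qed.

End FirstIterates.

Section DzeroEntries.
Context (R : realType).
Notation mu := (@lebesgue_measure R).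
Variables (s1 s2 : R -> R[i]) (m : R[i]).
Hypothesis i1 : cintegrable mu `[0, 1] s1.
Hypothesis i2 : cintegrable mu `[0, 1] s2.

Let al := twist (- m) s1.
Let be := twist m s2.

Lemma mx_addNE (M N : 'M[R[i]]_2) j k : (- M + N) j k = - M j k + N j k.
Proof. by rewrite !mxE. Qed.

Lemma mxintE (a b : R) (F : R -> 'M[R[i]]_2) j k :
  mxint a b F j k = cint a b (fun t => F t j k).
Proof. by rewrite mxE. Qed.

(** The second column is obtained from the first by exchanging the potentials and changing the
sign of [m], so each of the three identities above serves twice. *)
Lemma DzeroE (x : R) : x <= 1 -> Dzero s1 s2 m x =
  mx2 (wave (m / 2) x * iter2 al be x)
      (wave (m / 2) x * (- iter1 al x - iter3 be al x))
      (wave (- (m / 2)) x * (- iter1 be x - iter3 al be x))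
      (wave (- (m / 2)) x * iter2 be al x).
Proof.
move=> x1.
have mN : - m / 2 = - (m / 2) by rewrite mulNr.
have mNN : - (- m / 2) = m / 2 by rewrite mulNr opprK.
have H1 := cint_sconv_iter2 m i1 i2 x1.
have H2 := cint_Top_iter3 m i1 i2 x1.
have H3 := cint_s_iter1 m i2 x1.
have H1' := cint_sconv_iter2 (- m) i2 i1 x1.
have H2' := cint_Top_iter3 (- m) i2 i1 x1.
have H3' := cint_s_iter1 (- m) i1 x1.
rewrite ?mNN ?mN ?opprK -/al -/be in H1 H2 H3 H1' H2' H3'.
have JE t : mexp ((x - 2 * t)%:C *: Amx m) *m Jmx s1 s2 t =
    mx2 0 (wave (m / 2) (x - 2 * t) * s1 t) (wave (- (m / 2)) (x - 2 * t) * s2 t) 0.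
  by rewrite mexp_Amx mx2_diagM !mulr0.
have NE t : mexp ((x - 2 * t)%:C *: Amx m) *m Nmx s1 s2 x t =
    mx2 (wave (m / 2) (x - 2 * t) * sconv s1 s2 x t)
        (wave (m / 2) (x - 2 * t) * - Top s1 (sconv s2 s1) x t)
        (wave (- (m / 2)) (x - 2 * t) * - Top s2 (sconv s1 s2) x t)
        (wave (- (m / 2)) (x - 2 * t) * sconv s2 s1 x t).
  by rewrite mexp_Amx mx2_diagM.
have DE j k F N : (forall t, mx2 0 (wave (m / 2) (x - 2 * t) * s1 t)
        (wave (- (m / 2)) (x - 2 * t) * s2 t) 0 j k = F t) ->
    (forall t, mx2 (wave (m / 2) (x - 2 * t) * sconv s1 s2 x t)
        (wave (m / 2) (x - 2 * t) * - Top s1 (sconv s2 s1) x t)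
        (wave (- (m / 2)) (x - 2 * t) * - Top s2 (sconv s1 s2) x t)
        (wave (- (m / 2)) (x - 2 * t) * sconv s2 s1 x t) j k = N t) ->
    Dzero s1 s2 m x j k = - cint 0 x F + cint 0 x N.
  move=> HF HN.
  have E1 : mxint 0 x (fun t => mexp ((x - 2 * t)%:C *: Amx m) *m Jmx s1 s2 t) j k =
      cint 0 x F.
    by rewrite mxintE; apply: eq_cint => t _; rewrite -HF -JE.
  have E2 : mxint 0 x (fun t => mexp ((x - 2 * t)%:C *: Amx m) *m Nmx s1 s2 x t) j k =
      cint 0 x N.
    by rewrite mxintE; apply: eq_cint => t _; rewrite -HN -NE.
  exact: (etrans (mx_addNE _ _ _ _) (f_equal2 (fun a b => - a + b) E1 E2)).
have n0 (c : R[i]) : - 0 + c = c by rewrite oppr0 add0r.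
apply/matrixP; apply: ord2P; apply: ord2P; rewrite mx2E.
- rewrite (DE _ _ _ _ (fun t => mx2_00 _ _ _ _) (fun t => mx2_00 _ _ _ _)).
  exact: (etrans (f_equal2 (fun a b => - a + b) (cint_const0 x) H1) (n0 _)).
- rewrite (DE _ _ _ _ (fun t => mx2_01 _ _ _ _) (fun t => mx2_01 _ _ _ _)).
  by rewrite [X in - X + _]H3' [X in _ + X]H2' -mulrN -mulrDr.
- rewrite (DE _ _ _ _ (fun t => mx2_10 _ _ _ _) (fun t => mx2_10 _ _ _ _)).
  by rewrite [X in - X + _]H3 [X in _ + X]H2 -mulrN -mulrDr.
- rewrite (DE _ _ _ _ (fun t => mx2_11 _ _ _ _) (fun t => mx2_11 _ _ _ _)).
  exact: (etrans (f_equal2 (fun a b => - a + b) (cint_const0 x) H1') (n0 _)).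
Qed.

End DzeroEntries.

(** * Bounds by gamma2 *)

Section RemainderBound.
Context (R : realType).
Notation mu := (@lebesgue_measure R).
Variables (s1 s2 : R -> R[i]) (m : R[i]) (d p : R) (q : \bar R).
Hypothesis i1 : cintegrable mu `[0, 1] s1.
Hypothesis i2 : cintegrable mu `[0, 1] s2.
Hypothesis md : `|complex.Im m| <= d.
Hypothesis p1 : 1 <= p.
Hypothesis pq : ((p%:E)^-1 + q^-1 = 1)%E.

Let al := twist (- m) s1.
Let be := twist m s2.
Let E := expR (2 * d).

Let B := iter1 be.

Let mNd : `|complex.Im (- m)| <= d. Proof. by rewrite ImN normrN. Qed.

Lemma le_cabs_twist (s : R -> R[i]) (n : R[i]) t : `|complex.Im n| <= d -> 0 <= t <= 1 ->
  cabs (twist n s t) <= E * cabs (s t).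
Proof.
by move=> nd t01; rewrite /twist cabsM ler_wpM2r ?cabs_ge0// (le_cabs_wave nd t01).
Qed.

(** On the strip [|al| <= E |s1|].  Each term on the left is a product of two integrals against
[|al|], which gives [E^2], and [hoelder01] bounds the integral of [|s1| |B|]. *)
Lemma quadratic_bound :
  (((\int[mu]_(t in `[0, 1]) (cabs (al t) * cabs (B t))) ^+ 2 +
    \int[mu]_(t in `[0, 1]) cabs (al t) *
    \int[mu]_(t in `[0, 1]) (cabs (al t) * cabs (B t) ^+ 2))%:E <=
  (E ^+ 2)%:E * ((Lnorm01 p%:E s1 * Lnorm01 q B) ^+ 2 +
    Lnorm01 1 s1 * \int[mu]_(t in `[0%R, 1%R]) (cabs (s1 t) * cabs (B t) ^+ 2)%:E))%E.
Proof.
have E0 : 0 <= E by exact: expR_ge0.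
have ial : cintegrable mu `[0, 1] al by exact: cintegrable_wave.
have ibe : cintegrable mu `[0, 1] be by exact: cintegrable_wave.
have cB : ccont01 B by exact: ccont01_cint.
have mI : measurable (`[0, 1]%classic : set (measurableTypeR R)) by exact: measurable_itv.
(* used below for [f] equal to [B], [1] and [B * B] *)
have dom (f : R -> R[i]) : ccont01 f ->
    ((\int[mu]_(t in `[0, 1]) (cabs (al t) * cabs (f t)))%:E <=
     E%:E * \int[mu]_(t in `[0%R, 1%R]) (cabs (s1 t) * cabs (f t))%:E)%E.
  move=> cf.
  have iaf := cintegrable_cabs mI (ccont01_cintegrableM (lexx 1) ial cf).
  have isf := cintegrable_cabs mI (ccont01_cintegrableM (lexx 1) i1 cf).
  have mst : measurable_fun (`[0, 1]%classic : set (measurableTypeR R))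
      (fun t => (cabs (s1 t) * cabs (f t))%:E).
    apply: eq_measurable_fun (measurable_int _ isf) => t _; by rewrite cabsM.
  have -> : \int[mu]_(t in `[0, 1]) (cabs (al t) * cabs (f t)) =
      \int[mu]_(t in `[0, 1]) cabs (al t * f t).
    by apply: eq_Rintegral => t _; rewrite cabsM.
  rewrite /Rintegral fineK; last exact: (integrable_fin_num mI iaf).
  rewrite -ge0_integralZl//; last by move=> t _; rewrite lee_fin mulr_ge0 ?cabs_ge0.
  apply: ge0_le_integral => //.
  - by move=> t _; rewrite lee_fin cabs_ge0.
  - exact: measurable_int iaf.
  - exact: measurable_funeM.
  move=> t; rewrite /= in_itv /= => t01; rewrite lee_fin cabsM mulrA.
  by rewrite ler_wpM2r ?cabs_ge0//; exact: le_cabs_twist.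
have := dom _ cB; set Q := \int[mu]_(t in _) _ => HQ.
have := dom _ (ccont01_cst 1).
under eq_Rintegral do rewrite cabs1 mulr1.
under eq_integral do rewrite cabs1 mulr1.
rewrite -Lnorm01_1; set a := \int[mu]_(t in _) _ => Ha.
have := dom _ (ccont01M cB cB).
under eq_Rintegral do rewrite cabsM -expr2.
under eq_integral do rewrite cabsM -expr2.
set P := \int[mu]_(t in _) _ => HP.
have {}HQ : (Q%:E <= E%:E * (Lnorm01 p%:E s1 * Lnorm01 q B))%E.
  apply: (le_trans HQ); apply: lee_wpmul2l; first by rewrite lee_fin.
  by apply: hoelder01 => //; [exact: cintegrable_meas i1|exact: ccont01_cmeasurable].
have Q0 : 0 <= Q by apply: Rintegral_ge0 => t _; rewrite mulr_ge0 ?cabs_ge0.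
have a0 : 0 <= a by apply: Rintegral_ge0 => t _; exact: cabs_ge0.
have P0 : 0 <= P by apply: Rintegral_ge0 => t _; rewrite mulr_ge0 ?sqr_ge0 ?cabs_ge0.
rewrite expr2 EFinD !EFinM.
set X := (Lnorm01 p%:E s1 * _)%E; set Y := Lnorm01 1 s1; set Z := integral _ _ _.
have X0 : (0 <= X)%E by rewrite mule_ge0 ?Lnorm01_ge0.
have Y0 : (0 <= Y)%E by exact: Lnorm01_ge0.
have Z0 : (0 <= Z)%E.
  by apply: integral_ge0 => t _; rewrite lee_fin mulr_ge0 ?sqr_ge0 ?cabs_ge0.
rewrite [leRHS](_ : _ = (E%:E * X) * (E%:E * X) + (E%:E * Y) * (E%:E * Z))%E; last first.
  have X2 : (0 <= X ^+ 2)%E := mule_ge0 X0 X0.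
  rewrite ge0_muleDr//; last exact: mule_ge0 Y0 Z0.
  by rewrite (muleACA _ X) (muleACA _ Y).
by apply: leeD; apply: lee_pmul; rewrite ?lee_fin.
Qed.

End RemainderBound.

Section GammaBound.
Context (R : realType).
Notation mu := (@lebesgue_measure R).
Variables (s1 s2 : R -> R[i]) (m : R[i]) (p : R) (q : \bar R).
Hypothesis i1 : cintegrable mu `[0, 1] s1.
Hypothesis i2 : cintegrable mu `[0, 1] s2.

Lemma ccont01_fourier_plus s : cintegrable mu `[0, 1] s -> ccont01 (fourier_plus s m).
Proof. by move=> si; apply: ccont01_cint; exact: cintegrable_wave. Qed.

Lemma ccont01_fourier_minus s : cintegrable mu `[0, 1] s -> ccont01 (fourier_minus s m).
Proof.
move=> si; rewrite (funext (fourier_minusE s m)).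
by apply: ccont01_cint; exact: cintegrable_wave.
Qed.

(** The two columns use this with [s] one of the potentials and [b] one of the Fourier
integrals of the other; the hypotheses say that [s] and [b] contribute to the sums
defining [a1], [a2], [sigma0], [gamma] and [gamma0]. *)
Lemma gamma2_ge (s b : R -> R[i]) :
  cintegrable mu `[0, 1] s -> ccont01 b ->
  (Lnorm01 p%:E s <= a2 p s1 s2)%E -> (Lnorm01 1 s <= a1 s1 s2)%E ->
  (Lnorm01 q b <= gamma q s1 s2 m)%E ->
  (forall t, cabs (s t) <= sigma0 s1 s2 t) ->
  (forall t, cabs (b t) <= gamma0 s1 s2 t m) ->
  ((Lnorm01 p%:E s * Lnorm01 q b) ^+ 2 +
    Lnorm01 1 s * \int[mu]_(t in `[0%R, 1%R]) (cabs (s t) * cabs (b t) ^+ 2)%:E <=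
   gamma2 p q s1 s2 m)%E.
Proof.
move=> si cb Hp H1 Hq Hs Hb.
have mI : measurable (`[0, 1]%classic : set (measurableTypeR R)) by exact: measurable_itv.
have mcabs f : ccont01 f -> measurable_fun (`[0, 1]%classic : set (measurableTypeR R)) (fun t => cabs (f t)).
  by move=> cf; apply: cmeasurable_cabs; exact: ccont01_cmeasurable.
have mint f : cintegrable mu `[0, 1] f -> measurable_fun (`[0, 1]%classic : set (measurableTypeR R)) (fun t => cabs (f t)).
  by move=> fi; apply: cmeasurable_cabs; exact: cintegrable_meas fi.
rewrite /gamma2; apply: leeD.
  rewrite (_ : (_ * _) ^+ 2 = (Lnorm01 p%:E s * Lnorm01 p%:E s) * (Lnorm01 q b * Lnorm01 q b))%E.
    by apply: lee_pmul; rewrite ?mule_ge0 ?Lnorm01_ge0//; apply: lee_pmul; rewrite ?Lnorm01_ge0.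
  by rewrite [LHS]muleACA.
have mono t : cabs (s t) * cabs (b t) ^+ 2 <= sigma0 s1 s2 t * gamma0 s1 s2 t m ^+ 2.
  apply: ler_pM; rewrite ?cabs_ge0 ?sqr_ge0// lerXn2r ?nnegrE ?cabs_ge0//.
  exact: le_trans (cabs_ge0 _) (Hb t).
apply: lee_pmul => //; first exact: Lnorm01_ge0.
  by apply: integral_ge0 => t _; rewrite lee_fin mulr_ge0 ?sqr_ge0 ?cabs_ge0.
rewrite /gamma1; apply: ge0_le_integral => //.
- by move=> t _; rewrite lee_fin mulr_ge0 ?sqr_ge0 ?cabs_ge0.
- apply/measurable_EFinP; apply: measurable_funM; first exact: mint.
  by apply: measurable_funX; exact: mcabs.
- apply/measurable_EFinP; apply: measurable_funM.
    by apply: measurable_funD; exact: mint.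
  apply: measurable_funX; apply: measurable_funD; apply: measurable_funD; apply: mcabs.
  + exact: ccont01_fourier_minus.
  + exact: ccont01_fourier_plus.
  + exact: ccont01_fourier_minus.
  + exact: ccont01_fourier_plus.
- by move=> t _; rewrite lee_fin.
Qed.

End GammaBound.

Section Columns.
Context (R : realType).
Notation mu := (@lebesgue_measure R).
Variables (s1 s2 : R -> R[i]) (m : R[i]) (D : R -> 'M[R[i]]_2).
Hypothesis sol : is_solution s1 s2 m D.

Let odeE (x : R) : (exists2 D', is_derive_mx D x D' &
    D' + Jmx s1 s2 x *m D x = Amx m *m D x) ->
  [/\ is_cderive (fun x => D x ord0 ord0) x
        ('i%C * m * D x ord0 ord0 - s1 x * D x ord_max ord0),
      is_cderive (fun x => D x ord_max ord0) x
        (- ('i%C * m * D x ord_max ord0) - s2 x * D x ord0 ord0),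
      is_cderive (fun x => D x ord_max ord_max) x
        ('i%C * - m * D x ord_max ord_max - s2 x * D x ord0 ord_max) &
      is_cderive (fun x => D x ord0 ord_max) x
        (- ('i%C * - m * D x ord0 ord_max) - s1 x * D x ord_max ord_max)].
Proof.
move=> [D' dD /matrixP E].
have Dmx : D x = mx2 (D x ord0 ord0) (D x ord0 ord_max) (D x ord_max ord0) (D x ord_max ord_max).
  by apply/matrixP; apply: ord2P; apply: ord2P; rewrite mx2E.
have AE : Amx m = mx2 ('i%C * m) 0 0 (- ('i%C * m)).
  by apply/matrixP; apply: ord2P; apply: ord2P; rewrite /Amx /J0 mxE !mx2E ?mulr0 ?mulr1 ?mulrN1.
have LE j k : (D' + Jmx s1 s2 x *m D x) j k = D' j k + (Jmx s1 s2 x *m D x) j k.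
  by rewrite mxE.
have {}E j k : D' j k = (Amx m *m D x) j k - (Jmx s1 s2 x *m D x) j k.
  by rewrite -E LE addrK.
move: E; rewrite AE Dmx mx2_diagM /Jmx mx2M => E.
have E00 := E ord0 ord0; have E01 := E ord0 ord_max.
have E10 := E ord_max ord0; have E11 := E ord_max ord_max.
rewrite !mx2E in E00 E01 E10 E11.
split.
- by apply: is_cderive_eq (dD ord0 ord0) _; rewrite !mx2E E00; ring.
- by apply: is_cderive_eq (dD ord_max ord0) _; rewrite !mx2E E10; ring.
- by apply: is_cderive_eq (dD ord_max ord_max) _; rewrite !mx2E E11; ring.
- by apply: is_cderive_eq (dD ord0 ord_max) _; rewrite !mx2E E01; ring.
Qed.

Lemma solution_columns :
  [/\ {ae mu, forall x : R, x \in `[0%R, 1%R] ->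
        is_cderive (fun x => D x ord0 ord0) x
          ('i%C * m * D x ord0 ord0 - s1 x * D x ord_max ord0) /\
        is_cderive (fun x => D x ord_max ord0) x
          (- ('i%C * m * D x ord_max ord0) - s2 x * D x ord0 ord0)},
      {ae mu, forall x : R, x \in `[0%R, 1%R] ->
        is_cderive (fun x => D x ord_max ord_max) x
          ('i%C * - m * D x ord_max ord_max - s2 x * D x ord0 ord_max) /\
        is_cderive (fun x => D x ord0 ord_max) x
          (- ('i%C * - m * D x ord0 ord_max) - s1 x * D x ord_max ord_max)},
      D 0 ord0 ord0 = 1 /\ D 0 ord_max ord0 = 0 &
      D 0 ord_max ord_max = 1 /\ D 0 ord0 ord_max = 0].
Proof.
have [_ ode D0] := sol; have aeF := ae_filter_ringOfSetsType mu.
split.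
- by apply: filterS ode => x xode /xode/odeE[].
- by apply: filterS ode => x xode /xode/odeE[].
- by rewrite D0 !mxE.
- by rewrite D0 !mxE.
Qed.

End Columns.

Lemma mx_subDE (R : realType) (A M N : 'M[R[i]]_2) j k :
  (A - (M + N)) j k = A j k - (M j k + N j k).
Proof. by rewrite !mxE. Qed.

Section GammaColumns.
Context (R : realType).
Variables (s1 s2 : R -> R[i]) (m : R[i]) (p : R) (q : \bar R).
Hypothesis i1 : cintegrable lebesgue_measure `[0%R, 1%R] s1.
Hypothesis i2 : cintegrable lebesgue_measure `[0%R, 1%R] s2.

Lemma gamma2_ge_column1 :
  ((Lnorm01 p%:E s1 * Lnorm01 q (iter1 (twist m s2))) ^+ 2 +
    Lnorm01 1 s1 * \int[lebesgue_measure]_(t in `[0%R, 1%R])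
      (cabs (s1 t) * cabs (iter1 (twist m s2) t) ^+ 2)%:E <=
   gamma2 p q s1 s2 m)%E.
Proof.
apply: gamma2_ge => //; first exact: (ccont01_fourier_plus m i2).
- by rewrite /a2 leeDl ?Lnorm01_ge0.
- by rewrite /a1 leeDl ?Lnorm01_ge0.
- rewrite /gamma; apply: (@le_trans _ _ (Lnorm01 q (fourier_minus s2 m) +
      Lnorm01 q (fourier_plus s2 m))%E); first by rewrite leeDr ?Lnorm01_ge0.
  by rewrite leeDr ?adde_ge0 ?Lnorm01_ge0.
- by move=> t; rewrite /sigma0 lerDl cabs_ge0.
- move=> t; rewrite /gamma0; apply: (@le_trans _ _ (cabs (fourier_minus s2 m t) +
      cabs (fourier_plus s2 m t))); first by rewrite lerDr cabs_ge0.
  by rewrite lerDr addr_ge0 ?cabs_ge0.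
Qed.

Lemma gamma2_ge_column2 :
  ((Lnorm01 p%:E s2 * Lnorm01 q (iter1 (twist (- m)%R s1))) ^+ 2 +
    Lnorm01 1 s2 * \int[lebesgue_measure]_(t in `[0%R, 1%R])
      (cabs (s2 t) * cabs (iter1 (twist (- m)%R s1) t) ^+ 2)%:E <=
   gamma2 p q s1 s2 m)%E.
Proof.
have -> : iter1 (twist (- m) s1) = fourier_minus s1 m.
  by apply/funext => x; rewrite fourier_minusE.
apply: gamma2_ge => //; first exact: (ccont01_fourier_minus m i1).
- by rewrite /a2 leeDr ?Lnorm01_ge0.
- by rewrite /a1 leeDr ?Lnorm01_ge0.
- rewrite /gamma -addeA leeDl ?adde_ge0 ?Lnorm01_ge0//.
- by move=> t; rewrite /sigma0 lerDr cabs_ge0.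
- by move=> t; rewrite /gamma0 -addrA lerDl !addr_ge0 ?cabs_ge0.
Qed.

End GammaColumns.

(** * The asymptotic formula *)

Theorem lemma2p2 (R : realType) (s1 s2 : R -> R[i]) (d : R) :
  exists c : R,
  forall (p : R) (q : \bar R),
    1 <= p < 2 ->
    ((p%:E)^-1 + q^-1 = 1)%E ->
    in_Lp01 p s1 -> in_Lp01 p s2 ->
  forall (mu : R[i]) (D : R -> 'M[R[i]]_2),
    is_solution s1 s2 mu D ->
  exists D1 : R -> 'M[R[i]]_2,
    (forall x : R, 0 <= x <= 1 ->
       D x = mexp (x%:C *: Amx mu) + Dzero s1 s2 mu x + D1 x) /\
    (`|complex.Im mu| <= d ->
       in_MC01 D1 /\ (normMC01 D1 <= c%:E * gamma2 p q s1 s2 mu)%E).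
Proof.
(* [c] comes before the hypotheses on the potentials: if these are not integrable, no [p]
   satisfies the hypotheses and any [c] will do *)
have [[i1 i2]|notL1] := pselect (cintegrable lebesgue_measure `[0%R, 1%R] s1 /\
    cintegrable lebesgue_measure `[0%R, 1%R] s2); last first.
  exists 0 => p q /andP[p1 _] _ L1 L2; exfalso; apply: notL1.
  by split; [exact: in_Lp01_cintegrable p1 L1|exact: in_Lp01_cintegrable p1 L2].
pose E := expR (2 * d).
have E0 : 0 <= E by exact: expR_ge0.
(* a weight that dominates the coefficients of both Volterra systems on the whole strip *)
pose h t := E * (cabs (s1 t) + cabs (s2 t)).
have mI : measurable (`[0, 1]%classic : set (measurableTypeR R)) by exact: measurable_itv.
have ih : lebesgue_measure.-integrable `[0%R, 1%R] (EFin \o h).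
  apply: integrable_EFinZ => //.
  by apply: integrable_EFinD => //; exact: cintegrable_cabs.
have h0 t : 0 <= t <= 1 -> 0 <= h t by rewrite mulr_ge0 ?addr_ge0 ?cabs_ge0.
have [C C0 gron] := gronwall_L1 ih h0.
(* [E] for the wave restored in front of the remainder, [C] from Gronwall's inequality and
   [E ^+ 2] from [quadratic_bound]; the four entries contribute the factor [4] *)
pose M := E * (C * E ^+ 2).
have M0 : 0 <= M by rewrite !mulr_ge0 ?sqr_ge0// ltW.
exists (4 * M) => p q /andP[p1 _] pq L1 L2 m D sol.
exists (fun x => D x - (mexp (x%:C *: Amx m) + Dzero s1 s2 m x)).
split => [x _|md]; first by rewrite addrC subrK.
have [ode1 ode2 [D00 D10] [D11 D01]] := solution_columns sol.
have [acD _ _] := sol.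
have mNd : `|complex.Im (- m)| <= d by rewrite ImN normrN.
have lh1 n t : `|complex.Im n| <= d -> 0 <= t <= 1 -> cabs (twist n s1 t) <= h t.
  move=> nd t01; rewrite (le_trans (le_cabs_twist _ nd t01))// ler_wpM2l//.
  by rewrite lerDl cabs_ge0.
have lh2 n t : `|complex.Im n| <= d -> 0 <= t <= 1 -> cabs (twist n s2 t) <= h t.
  move=> nd t01; rewrite (le_trans (le_cabs_twist _ nd t01))// ler_wpM2l//.
  by rewrite lerDr cabs_ge0.
have [r1 [w1 [cr1 cw1 col1]]] := column_remainder i1 i2 (acD _ _) (acD _ _) D00 D10 ode1
  ih (fun t => lh1 _ t mNd) (fun t => lh2 _ t md) gron.
have mNNd : `|complex.Im (- - m)| <= d by rewrite opprK.
have [r2 [w2 [cr2 cw2 col2]]] := column_remainder i2 i1 (acD _ _) (acD _ _) D11 D01 ode2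
  ih (fun t => lh2 _ t mNNd) (fun t => lh1 _ t mNd) gron.
rewrite opprK !mulNr opprK in col2.
have bound1 := quadratic_bound i1 i2 md p1 pq.
have bound2 := quadratic_bound i2 i1 mNd p1 pq.
rewrite opprK in bound2.
set G := gamma2 p q s1 s2 m.
have tail (k : R) : (k%:E <= (E ^+ 2)%:E * G)%E ->
    forall W z w : R[i], cabs W <= E -> cabs z + cabs w <= C * k ->
    ((cabs (W * z))%:E <= M%:E * G)%E /\ ((cabs (W * w))%:E <= M%:E * G)%E.
  move=> kG W z w WE zw.
  have b0 y : cabs y <= C * k -> ((cabs (W * y))%:E <= M%:E * G)%E.
    move=> yk; apply: (@le_trans _ _ (E * (C * k))%:E).
      by rewrite lee_fin cabsM ler_pM ?cabs_ge0.
    have -> : (M%:E = E%:E * (C%:E * (E ^+ 2)%:E))%E by [].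
    have -> : ((E * (C * k))%:E = E%:E * (C%:E * k%:E))%E by [].
    rewrite -[leRHS]muleA lee_wpmul2l ?lee_fin// -[leRHS]muleA.
    by apply: lee_wpmul2l => //; rewrite lee_fin ltW.
  split; apply: b0.
    by rewrite (le_trans _ zw)// lerDl cabs_ge0.
  by rewrite (le_trans _ zw)// lerDr cabs_ge0.
have E20 : (0%:E <= (E ^+ 2)%:E)%E by rewrite lee_fin sqr_ge0.
have {}tail1 := tail _ (le_trans bound1 (lee_wpmul2l E20 (gamma2_ge_column1 m p q i1 i2))).
have {}tail2 := tail _ (le_trans bound2 (lee_wpmul2l E20 (gamma2_ge_column2 m p q i1 i2))).
have WE n x : `|complex.Im n| <= d -> 0 <= x <= 1 -> cabs (wave (n / 2) x) <= E.
  move=> nd x01; apply: le_cabs_wave => //.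
  have -> : complex.Im (n / 2) = complex.Im n / 2.
    rewrite (_ : n / 2 = n * (2^-1)%:C); first by rewrite ImM /= mulr0 add0r.
    by rewrite fmorphV rmorph_nat.
  rewrite normrM (@le_trans _ _ `|complex.Im n|)//.
  by rewrite ler_piMr// ger0_norm// invf_le1// ler1n.
have DE x j k : 0 <= x <= 1 -> (D x - (mexp (x%:C *: Amx m) + Dzero s1 s2 m x)) j k =
    mx2 (wave (m / 2) x * r1 x) (wave (m / 2) x * w2 x)
        (wave (- (m / 2)) x * w1 x) (wave (- (m / 2)) x * r2 x) j k.
  move=> x01; have [_ x1] := andP x01.
  have [y1 z1 _] := col1 x x01; have [y2 z2 _] := col2 x x01.
  rewrite mx_subDE mexp_Amx (DzeroE m i1 i2 x1).
  move: j k; apply: ord2P; apply: ord2P; rewrite !mx2E.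
  - by rewrite y1; ring.
  - by rewrite z2; ring.
  - by rewrite z1; ring.
  - by rewrite y2; ring.
split.
  move=> j k.
  have cE : ccont01 (fun x => mx2 (wave (m / 2) x * r1 x) (wave (m / 2) x * w2 x)
      (wave (- (m / 2)) x * w1 x) (wave (- (m / 2)) x * r2 x) j k).
    move: j k; apply: ord2P; apply: ord2P; (under [X in ccont01 X]eq_fun do rewrite mx2E);
      by apply: ccont01M => //; exact: ccont01_wave.
  by apply: eq_ccont01 cE => x x01; rewrite DE.
have G0 : (0 <= G)%E.
  apply: le_trans (gamma2_ge_column1 m p q i1 i2); rewrite adde_ge0//.
    by rewrite sqre_ge0.
  rewrite mule_ge0 ?Lnorm01_ge0//; apply: integral_ge0 => t _.
  by rewrite lee_fin mulr_ge0 ?sqr_ge0 ?cabs_ge0.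
have MG0 : (0 <= M%:E * G)%E by rewrite mule_ge0 ?lee_fin.
rewrite /normMC01; apply: (@le_trans _ _ (\sum_(j < 2) \sum_(k < 2) (M%:E * G))%E).
  apply: lee_sum => j _; apply: lee_sum => k _.
  apply: ge_ereal_sup => _ [x x01 <-].
  have {}x01 : 0 <= x <= 1 by move: x01; rewrite /= in_itv.
  rewrite (DE x j k x01).
  have [_ _ b1] := col1 x x01; have [_ _ b2] := col2 x x01.
  move: j k; apply: ord2P; apply: ord2P; rewrite mx2E.
  - by have [] := tail1 (wave (m / 2) x) _ _ (WE _ _ md x01) b1.
  - by have [] := tail2 (wave (m / 2) x) _ _ (WE _ _ md x01) b2.
  - have [] := tail1 (wave (- (m / 2)) x) _ _ _ b1 => //.
    by rewrite -mulNr; exact: WE.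
  - have [] := tail2 (wave (- (m / 2)) x) _ _ _ b2 => //.
    by rewrite -mulNr; exact: WE.
have -> : ((4 * M)%:E * G = ((1 + 1) + (1 + 1)) * (M%:E * G))%E.
  by rewrite muleA; congr (_ * _)%E; rewrite -!EFinD -EFinM; congr (_%:E); ring.
by rewrite !big_ord_recl !big_ord0 !adde0 !ge0_muleDl ?adde_ge0// !mul1e.
Qed.
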